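(* Consider the weakly convex game with $0<\eta<\min_i\rho_i^{-1}$ and $\mu>0$, and assume (C1): for every $i$, every $x_i\in X_i$ and all $y,w\in X$, $\|\nabla_{x_i}\hat f_i^\eta(x_i,y)-\nabla_{x_i}\hat f_i^\eta(x_i,w)\|\le\hat L_i\|y_i-w_i\|+\hat L_{-i}\|y_{-i}-w_{-i}\|$; and (C2): the spectral norm of $\Gamma_2$ is $<1$. Then: (i) for all $y,w\in X$, $(\|\hat x^\eta_i(y)-\hat x^\eta_i(w)\|)_{i=1}^N\le\Gamma_2(\|y_i-w_i\|)_{i=1}^N$ componentwise, so $\hat x^\eta:X\to X$ is a contraction (w.r.t. $\|x\|_*=\|(\|x_1\|,\dots,\|x_N\|)\|_2$) with a unique fixed point $x^*$; (ii) $x^*$ is the unique QNE of the Moreau-smoothed game over $X$, i.e. the unique $x\in X$ with $\nabla_{x_i}f_i^\eta(x)^\top(z_i-x_i)\ge0$ for all $z_i\in X_i$ and all $i$; if in addition each $X_i$ is compact and each $\partial_{x_i}f_i(\cdot,x_{-i})$ is $L_i$-Lipschitz, then $x^*$ is an $\eta LDM^*$-QNE of the original game, with $L=\max_iL_i$, $D=\max_i\operatorname{diam}(X_i)$, $M^*=\max_i\|\nabla_{x_i}f_i^\eta(x^* )\|$; (iii) if $\varepsilon_i^k\ge0$ with $\sum_k\varepsilon_i^k<\infty$ for all $i$, the MS-SSBR iterates satisfy $x^k\to x^*$ almost surely.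
   Context: $N$-player game: player $i$ has nonempty closed convex $X_i\subseteq\mathbb{R}^{n_i}$ and real-valued $f_i$ with $f_i(\cdot,x_{-i})$ $\rho_i$-weakly convex ($f_i+\frac{\rho_i}2\|\cdot\|^2$ convex) for each $x_{-i}$; $X=\prod_iX_i$. Moreau envelope $f_i^\eta(x_i,x_{-i})=\min_y\{f_i(y,x_{-i})+\frac1{2\eta}\|y-x_i\|^2\}$. Quadratic surrogate near $y\in X$: $\hat f_i^\eta(z,y)\triangleq f_i^\eta(y)+\nabla_{x_i}f_i^\eta(y)^\top(z-y_i)+\frac\mu2\|z-y_i\|^2$. Best response $\hat x_i^\eta(x)\triangleq\operatorname*{argmin}_{z\in X_i}\hat f_i^\eta(z,x)$. $\Gamma_2\in\mathbb{R}^{N\times N}$: $(\Gamma_2)_{ii}=\hat L_i/\mu$, $(\Gamma_2)_{ij}=\hat L_{-i}/\mu$ for $j\ne i$. QNE / $\epsilon$-QNE of the original game: $x\in X$ with $f_i'(x_i,x_{-i};z_i-x_i)\ge-\epsilon$ for all $z_i\in X_i$, all $i$ ($\epsilon=0$ for QNE), $f_i'$ the directional derivative in $x_i$. Subdifferential of a $\rho$-weakly convex $g$: $\partial(g+\frac\rho2\|\cdot\|^2)-\rho x$; a set-valued $F$ is $L$-Lipschitz if $F(u)\subseteq F(v)+L\|u-v\|\mathbb{B}$. MS-SSBR: $x^0\in X$; at iteration $k$ each player $i$ produces random $x_i^{k+1}\in X_i$ with $\mathbb{E}[\|x_i^{k+1}-\hat x_i^\eta(x^k)\|^2\mid x^k]\le(\varepsilon_i^k)^2$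 a.s. *)

(* Defs.v *)
From HB Require Import structures.
From mathcomp Require Import all_boot all_order all_algebra.
From mathcomp Require Import all_classical all_reals all_analysis.
Unset Strict Implicit. Unset Printing Implicit Defensive.
Import Order.TTheory GRing.Theory Num.Theory.
Import numFieldNormedType.Exports.
Local Open Scope classical_set_scope.
Local Open Scope ring_scope.

Section Game.
Variables (R : realType) (N : nat) (n : 'I_N -> nat).

Definition prof := forall i : 'I_N, 'rV[R]_(n i).

Definition upd (x : prof) (i : 'I_N) (z : 'rV[R]_(n i)) : prof :=
  @dfwith _ (fun j => 'rV[R]_(n j)) x i z.

Definition fnorm {m p} (A : 'M[R]_(m, p)) : R :=
  Num.sqrt (\sum_(i < m) \sum_(j < p) A i j ^+ 2).
Definition dotv {p} (u v : 'rV[R]_p) : R := \sum_(j < p) u 0 j * v 0 j.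

Definition pdist (x y : prof) : R :=
  Num.sqrt (\sum_(i < N) fnorm (x i - y i) ^+ 2).
Definition pdist_minus (i : 'I_N) (x y : prof) : R :=
  Num.sqrt (\sum_(j < N | j != i) fnorm (x j - y j) ^+ 2).

Definition grad {p} (F : 'rV[R]_p -> R) (z : 'rV[R]_p) : 'rV[R]_p :=
  \row_(j < p) derive F z (delta_mx 0 j : 'rV[R]_p).
Definition pgrad (F : prof -> R) (i : 'I_N) (x : prof) : 'rV[R]_(n i) :=
  grad (fun z => F (upd x i z)) (x i).

Definition moreau (eta : R) (F : prof -> R) (i : 'I_N) (x : prof) : R :=
  inf (range (fun y : 'rV[R]_(n i) =>
         F (upd x i y) + (2 * eta)^-1 * fnorm (y - x i) ^+ 2)).

Definition surr (eta mu : R) (F : prof -> R) (i : 'I_N)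
    (z : 'rV[R]_(n i)) (y : prof) : R :=
  moreau eta F i y + dotv (pgrad (moreau eta F i) i y) (z - y i)
  + mu / 2 * fnorm (z - y i) ^+ 2.

Definition bestresp (X : forall i : 'I_N, set 'rV[R]_(n i)) (eta mu : R)
    (f : 'I_N -> prof -> R) (x : prof) : prof :=
  fun i => xget 0 [set z | X i z /\
     forall z', X i z' -> surr eta mu (f i) i z x <= surr eta mu (f i) i z' x].

Definition Gamma2 (mu : R) (Lh Lhm : 'I_N -> R) : 'M[R]_N :=
  \matrix_(i, j) (if i == j then Lh i / mu else Lhm i / mu).

End Game.

Arguments prof R {N} n.
Arguments fnorm {R m p} A.
Arguments dotv {R p} u v.
Arguments grad {R p} F z.
Arguments upd {R N n} x i z.
Arguments pdist {R N n} x y.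
Arguments pdist_minus {R N n} i x y.
Arguments pgrad {R N n} F i x.
Arguments moreau {R N n} eta F i x.
Arguments surr {R N n} eta mu F i z y.
Arguments bestresp {R N n} X eta mu f x i.
Arguments Gamma2 {R N} mu Lh Lhm.

Definition specnorm {R : realType} {m} (A : 'M[R]_m) : R :=
  sup [set fnorm (A *m v) | v in [set v : 'cV[R]_m | fnorm v <= 1]].

Definition ddir {R : realType} {p} (F : 'rV[R]_p -> R) (z d : 'rV[R]_p) : R :=
  lim ((fun t : R => t^-1 * (F (z + t *: d) - F z)) @ 0^'+).

Definition csubdiff {R : realType} {p} (G : 'rV[R]_p -> R) (u : 'rV[R]_p)
  : set 'rV[R]_p := [set v | forall w, G u + dotv v (w - u) <= G w].
Definition wsubdiff {R : realType} {p} (rho : R) (G : 'rV[R]_p -> R)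
  (u : 'rV[R]_p) : set 'rV[R]_p :=
  [set v - rho *: u | v in csubdiff (fun z => G z + rho / 2 * fnorm z ^+ 2) u].

Definition setLipschitz {R : realType} {p} (L : R)
  (S : 'rV[R]_p -> set 'rV[R]_p) :=
  forall u v a, S u a -> exists2 b, S v b & fnorm (a - b) <= L * fnorm (u - v).

Definition diam {R : realType} {p} (A : set 'rV[R]_p) : R :=
  sup [set r | exists a b, [/\ A a, A b & r = fnorm (a - b)]].

Definition prof_open {R : realType} {N} {n : 'I_N -> nat} (A : set (prof R n)) :=
  forall x, A x -> exists2 r : R, 0 < r & forall y, pdist x y < r -> A y.
Definition prof_borel {R : realType} {N} {n : 'I_N -> nat} : set (set (prof R n)) :=
  smallest (sigma_algebra setT) (@prof_open R N n).

(* E[Y | G] <= c almost surely: some version g of the conditional expectation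
   of the nonnegative Y given the sigma-algebra G satisfies g <= c a.s. *)
Definition cexp_le_as {R : realType} {d} {T : measurableType d}
  (P : probability T R) (G : set (set T)) (Y : T -> R) (c : R) :=
  exists g : T -> R,
    [/\ (forall A : set R, measurable A -> G (g @^-1` A)),
        (forall B, G B -> (\int[P]_(w in B) (g w)%:E = \int[P]_(w in B) (Y w)%:E)%E)
      & {ae P, forall w, g w <= c}].

Definition inX {R : realType} {N} {n : 'I_N -> nat}
  (X : forall i : 'I_N, set 'rV[R]_(n i)) (x : prof R n) := forall i, X i (x i).

Definition smoothed_qne {R : realType} {N} {n : 'I_N -> nat}
  (X : forall i : 'I_N, set 'rV[R]_(n i)) (f : 'I_N -> prof R n -> R) (eta : R)
  (x : prof R n) :=
  inX X x /\ forall i z, X i z -> 0 <= dotv (pgrad (moreau eta (f i) i) i x) (z - x i).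

Definition eps_qne {R : realType} {N} {n : 'I_N -> nat}
  (X : forall i : 'I_N, set 'rV[R]_(n i)) (f : 'I_N -> prof R n -> R) (eps : R)
  (x : prof R n) :=
  inX X x /\ forall i z, X i z ->
    - eps <= ddir (fun u => f i (upd x i u)) (x i) (z - x i).

(* Main.v *)
(** The best response minimises over [X i] a quadratic of curvature [mu], so
    comparing the two first-order variational inequalities bounds
    [mu * |x^_i(y) - x^_i(w)|] by the difference of the surrogate gradients at any
    common point; (C1) then gives the bound by [Gamma2], and (C2) a contraction.
    A fixed point satisfies exactly the variational inequality of the smoothed
    game.  The gradient of the Moreau envelope at [x] is [(x - q) / eta] with [q]
    the proximal point, which is also a weak subgradient at [q]; Lipschitz
    continuity of the subdifferential moves it to a subgradient at [x] with error
    [L * eta * |grad|], and subgradients minorise directional derivatives.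
    For the stochastic scheme, the errors have summable expectations, hence are
    almost surely summable, and a contraction with summable errors converges. *)
Require Import Defs.
From HB Require Import structures.
From mathcomp Require Import all_boot all_order all_algebra.
From mathcomp Require Import all_classical all_reals all_analysis.
From mathcomp Require Import measurable_realfun ring lra.
Import Order.TTheory GRing.Theory Num.Theory.
Import numFieldNormedType.Exports.
Local Open Scope classical_set_scope.
Local Open Scope ring_scope.

(** * Euclidean geometry of row vectors *)

(** Minkowski from Cauchy-Schwarz, itself obtained from the nonnegativity of the sum of
    [(s * a i - t * b i) ^+ 2]. The filtered sum lets it serve both coordinates of a vector and
    blocks of a profile. *)
Lemma sum_sqr_minkowski {R : realType} {I : finType} (P : pred I) (a b : I -> R) :
  Num.sqrt (\sum_(i | P i) (a i + b i) ^+ 2)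
    <= Num.sqrt (\sum_(i | P i) a i ^+ 2) + Num.sqrt (\sum_(i | P i) b i ^+ 2).
Proof.
set A := \sum_(i | P i) a i ^+ 2; set B := \sum_(i | P i) b i ^+ 2.
set C := \sum_(i | P i) a i * b i.
have A0 : 0 <= A by apply: sumr_ge0 => i _; exact: sqr_ge0.
have B0 : 0 <= B by apply: sumr_ge0 => i _; exact: sqr_ge0.
have quad s t : 0 <= s ^+ 2 * A + t ^+ 2 * B - s * t * C *+ 2.
  rewrite /A /B /C !mulr_sumr -sumrMnl -big_split /= -sumrB.
  apply: sumr_ge0 => i _.
  have -> : s ^+ 2 * a i ^+ 2 + t ^+ 2 * b i ^+ 2 - s * t * (a i * b i) *+ 2
    = (s * a i - t * b i) ^+ 2 by ring.
  exact: sqr_ge0.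
have sA := sqrtr_ge0 A; have sB := sqrtr_ge0 B.
have qA := sqr_sqrtr A0; have qB := sqr_sqrtr B0.
have CS : C <= Num.sqrt A * Num.sqrt B.
  have [A00|A_neq0] := eqVneq A 0.
    have a0 i : P i -> a i = 0.
      move=> Pi; have /eqP := A00; rewrite psumr_eq0; last by move=> j _; exact: sqr_ge0.
      by move=> /allP /(_ i (mem_index_enum i)); rewrite Pi sqrf_eq0 => /eqP.
    rewrite /C big1 ?mulr_ge0// => i Pi; by rewrite a0// mul0r.
  have [B00|B_neq0] := eqVneq B 0.
    have b0 i : P i -> b i = 0.
      move=> Pi; have /eqP := B00; rewrite psumr_eq0; last by move=> j _; exact: sqr_ge0.
      by move=> /allP /(_ i (mem_index_enum i)); rewrite Pi sqrf_eq0 => /eqP.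
    rewrite /C big1 ?mulr_ge0// => i Pi; by rewrite b0// mulr0.
  have pA : 0 < Num.sqrt A by rewrite sqrtr_gt0 lt_neqAle eq_sym A_neq0.
  have pB : 0 < Num.sqrt B by rewrite sqrtr_gt0 lt_neqAle eq_sym B_neq0.
  (* This choice of [s] and [t] makes both square terms equal to [A * B]. *)
  have := quad (Num.sqrt B) (Num.sqrt A); rewrite qA qB => h.
  have pAB : 0 < Num.sqrt A * Num.sqrt B by rewrite mulr_gt0.
  rewrite -(ler_pM2l pAB).
  have -> : Num.sqrt A * Num.sqrt B * (Num.sqrt A * Num.sqrt B) = A * B.
    by rewrite -[in RHS]qA -[in RHS]qB; ring.
  by move: h; rewrite mulr2n; lra.
rewrite -(ler_pXn2r (_ : 0 < 2)%N) ?nnegrE ?addr_ge0 ?sqrtr_ge0//.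
rewrite sqr_sqrtr; last by apply: sumr_ge0 => i _; exact: sqr_ge0.
have -> : \sum_(i | P i) (a i + b i) ^+ 2 = A + B + C *+ 2.
  rewrite /A /B /C -sumrMnl -!big_split /=; apply: eq_bigr => i _; ring.
rewrite sqrrD qA qB; lra.
Qed.

Lemma fnorm_ge0 {R : realType} {m p} (A : 'M[R]_(m, p)) : 0 <= fnorm A.
Proof. exact: sqrtr_ge0. Qed.

Lemma fnorm_rowE {R : realType} {p} (u : 'rV[R]_p) :
  fnorm u = Num.sqrt (\sum_(j < p) u 0 j ^+ 2).
Proof. by rewrite /fnorm big_ord1. Qed.

Lemma fnorm_colE {R : realType} {p} (u : 'cV[R]_p) :
  fnorm u = Num.sqrt (\sum_(j < p) u j 0 ^+ 2).
Proof. by rewrite /fnorm; congr Num.sqrt; apply: eq_bigr => i _; rewrite big_ord1. Qed.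

Lemma fnorm_sqr {R : realType} {p} (u : 'rV[R]_p) : fnorm u ^+ 2 = dotv u u.
Proof.
rewrite fnorm_rowE sqr_sqrtr; last by apply: sumr_ge0 => i _; exact: sqr_ge0.
by apply: eq_bigr => j _; rewrite expr2.
Qed.

Lemma dotvC {R : realType} {p} (u v : 'rV[R]_p) : dotv u v = dotv v u.
Proof. by apply: eq_bigr => j _; rewrite mulrC. Qed.

Lemma dotvDl {R : realType} {p} (u v w : 'rV[R]_p) : dotv (u + v) w = dotv u w + dotv v w.
Proof. by rewrite /dotv -big_split; apply: eq_bigr => j _; rewrite mxE mulrDl. Qed.

Lemma dotvZl {R : realType} {p} a (u w : 'rV[R]_p) : dotv (a *: u) w = a * dotv u w.
Proof. by rewrite /dotv mulr_sumr; apply: eq_bigr => j _; rewrite mxE mulrA. Qed.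

Lemma dotvNl {R : realType} {p} (u w : 'rV[R]_p) : dotv (- u) w = - dotv u w.
Proof. by rewrite -scaleN1r dotvZl mulN1r. Qed.

Lemma dotvDr {R : realType} {p} (u v w : 'rV[R]_p) : dotv w (u + v) = dotv w u + dotv w v.
Proof. by rewrite dotvC dotvDl !(dotvC w). Qed.

Lemma dotvZr {R : realType} {p} a (u w : 'rV[R]_p) : dotv w (a *: u) = a * dotv w u.
Proof. by rewrite dotvC dotvZl dotvC. Qed.

Lemma dotvNr {R : realType} {p} (u w : 'rV[R]_p) : dotv w (- u) = - dotv w u.
Proof. by rewrite dotvC dotvNl dotvC. Qed.

Definition dotv_lin := (@dotvDl, @dotvDr, @dotvZl, @dotvZr, @dotvNl, @dotvNr).

Lemma fnormZ {R : realType} {p} a (u : 'rV[R]_p) : fnorm (a *: u) = `|a| * fnorm u.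
Proof.
rewrite !fnorm_rowE -sqrtr_sqr -sqrtrM ?sqr_ge0// mulr_sumr; congr Num.sqrt.
by apply: eq_bigr => j _; rewrite mxE exprMn.
Qed.

Lemma fnormN {R : realType} {p} (u : 'rV[R]_p) : fnorm (- u) = fnorm u.
Proof. by rewrite -scaleN1r fnormZ normrN normr1 mul1r. Qed.

Lemma fnorm_distC {R : realType} {p} (u v : 'rV[R]_p) : fnorm (u - v) = fnorm (v - u).
Proof. by rewrite -fnormN opprB. Qed.

Lemma fnorm_row0 {R : realType} {p} : fnorm (0 : 'rV[R]_p) = 0.
Proof. by rewrite -(scale0r 0) fnormZ normr0 mul0r. Qed.

Lemma fnormD {R : realType} {p} (u v : 'rV[R]_p) : fnorm (u + v) <= fnorm u + fnorm v.
Proof.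
rewrite !fnorm_rowE; under eq_bigr do rewrite mxE; exact: sum_sqr_minkowski.
Qed.

Lemma fnorm_tri {R : realType} {p} (v u w : 'rV[R]_p) :
  fnorm (u - w) <= fnorm (u - v) + fnorm (v - w).
Proof. by rewrite -[u - w](subrKA v); exact: fnormD. Qed.

(** Cauchy-Schwarz, read back from the squared triangle inequality. *)
Lemma dotv_le {R : realType} {p} (u v : 'rV[R]_p) : dotv u v <= fnorm u * fnorm v.
Proof.
have h := fnormD u v.
have : fnorm (u + v) ^+ 2 <= (fnorm u + fnorm v) ^+ 2.
  by rewrite ler_pXn2r ?nnegrE ?addr_ge0 ?fnorm_ge0.
rewrite sqrrD fnorm_sqr !dotv_lin (dotvC v u) !fnorm_sqr mulr2n; lra.
Qed.

Lemma dotv_ge {R : realType} {p} (u v : 'rV[R]_p) : - (fnorm u * fnorm v) <= dotv u v.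
Proof. by have := dotv_le (- u) v; rewrite dotvNl fnormN; lra. Qed.

Lemma fnorm_eq0 {R : realType} {p} (u : 'rV[R]_p) : fnorm u <= 0 -> u = 0.
Proof.
move=> u0; have {}u0 : fnorm u = 0 by apply/eqP; rewrite eq_le u0 fnorm_ge0.
have := fnorm_sqr u; rewrite u0 expr0n /= => /esym/eqP.
rewrite psumr_eq0; last by move=> j _; rewrite -expr2 sqr_ge0.
move=> /allP h; apply/rowP => j; rewrite mxE.
by have := h j (mem_index_enum j); rewrite /= mulf_eq0 orbb => /eqP.
Qed.

Lemma coord_le_fnorm {R : realType} {p} (u : 'rV[R]_p) j : `|u 0 j| <= fnorm u.
Proof.
rewrite fnorm_rowE -sqrtr_sqr ler_wsqrtr// (bigD1 j)//= lerDl.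
by apply: sumr_ge0 => i _; exact: sqr_ge0.
Qed.

Lemma sqrt_sum_sqr_le {R : realType} {I : finType} (P : pred I) (a : I -> R) :
  (forall i, P i -> 0 <= a i) ->
  Num.sqrt (\sum_(i | P i) a i ^+ 2) <= \sum_(i | P i) a i.
Proof.
move=> a0; have s0 : 0 <= \sum_(i | P i) a i by exact: sumr_ge0.
rewrite -(ger0_norm s0) -sqrtr_sqr ler_wsqrtr// expr2 mulr_suml ler_sum// => i Pi.
rewrite expr2 ler_wpM2l ?a0// (bigD1 i)//= lerDl.
by apply: sumr_ge0 => j /andP[Pj _]; exact: a0.
Qed.

Lemma fnorm_cvg_row {R : realType} {p} (u : nat -> 'rV[R]_p) (l : 'rV[R]_p) :
  (forall j, (fun k => u k 0 j) @ \oo --> l 0 j) ->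
  (fun k => fnorm (u k - l)) @ \oo --> (0 : R).
Proof.
move=> ul; under eq_fun do rewrite fnorm_rowE.
have sq : (fun k => \sum_(j < p) (u k - l) 0 j ^+ 2) @ \oo --> \sum_(j < p) (0 : R).
  apply: cvg_big => [|j _]; first exact: add_continuous.
  have -> : (0 : R) = (l 0 j - l 0 j) ^+ 2 by rewrite subrr expr0n.
  under eq_fun do rewrite !mxE expr2.
  by rewrite expr2; apply: cvgM; apply: cvgB => //; exact: cvg_cst.
rewrite big1// in sq.
by have := cvg_comp _ _ sq (@sqrt_continuous R 0); rewrite sqrtr0.
Qed.

Lemma fnorm_complete {R : realType} {p} (u : nat -> 'rV[R]_p) :
  (forall e : R, 0 < e -> exists K, forall k l, (K <= k)%N -> (K <= l)%N -> fnorm (u k - u l) < e) ->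
  exists l, (fun k => fnorm (u k - l)) @ \oo --> (0 : R).
Proof.
move=> cu.
have cj j : cvgn (fun k => u k 0 j).
  apply/cauchy_cvgP; apply: cauchy_exP => e e0.
  have [K hK] := cu _ e0.
  exists (u K 0 j); exists K => // k /= Kk; rewrite /ball /=.
  apply: le_lt_trans (hK _ _ (leqnn K) Kk).
  by have := coord_le_fnorm (u K - u k) j; rewrite !mxE.
exists (\row_j limn (fun k => u k 0 j)); apply: fnorm_cvg_row => j; rewrite mxE; exact: cj.
Qed.

(** The topology behind [closed] is entrywise, and each entry is bounded by the Euclidean norm. *)
Lemma closed_fnorm {R : realType} {p} (S : set 'rV[R]_p) (u : nat -> 'rV[R]_p) l :
  closed S -> (forall k, S (u k)) -> (fun k => fnorm (u k - l)) @ \oo --> (0 : R) -> S l.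
Proof.
move=> Scl Su ul; apply: Scl => B /nbhs_ballP[e /= e0 eB].
have /cvgrPdist_lt/(_ _ e0)[K _ /(_ K (leqnn _))] := ul.
rewrite sub0r normrN ger0_norm ?fnorm_ge0// => h.
exists (u K); split => //; apply: eB; split => // i j; rewrite ord1 /ball /=; apply: le_lt_trans h.
by rewrite fnorm_distC; have := coord_le_fnorm (l - u K) j; rewrite !mxE.
Qed.

(** * Strongly convex minimisation *)

Lemma inv_succ_eventually_lt {R : realType} {e : R} : 0 < e ->
  exists K, forall k, (K <= k)%N -> k.+1%:R^-1 < e.
Proof.
by move=> e0; have [K _ h] := near_infty_natSinv_lt (PosNum e0); exists K => k /h.
Qed.

(** Strong convexity at midpoints makes minimising sequences Cauchy, so no compactness is involved.
    The cone minorants bound [H] below and stand in for lower semicontinuity at the limit; the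
    growth at [q] is the midpoint inequality for [y] and [q]. *)
Lemma strongly_convex_min {R : realType} {p} (S : set 'rV[R]_p) (H : 'rV[R]_p -> R) (c : R) :
  0 < c -> S !=set0 -> closed S ->
  (forall a b, S a -> S b -> S (2^-1 *: (a + b))) ->
  (forall a b, S a -> S b ->
     H (2^-1 *: (a + b)) <= (H a + H b) / 2 - c * fnorm (a - b) ^+ 2) ->
  (forall u, S u -> exists K, forall y, S y -> H u - K * fnorm (y - u) <= H y) ->
  exists2 q, S q & forall y, S y -> H q + 2 * c * fnorm (y - q) ^+ 2 <= H y.
Proof.
move=> c0 [u0 Su0] Scl Smid Hmid Hlow.
have [K0 hK0] := Hlow _ Su0.
have midE (a b : 'rV[R]_p) : 2^-1 *: (a + b) - b = 2^-1 *: (a - b).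
  by apply/rowP => j; rewrite !mxE; field.
have half_ge0 : (0 : R) <= 2^-1 by rewrite invr_ge0.
have lbH : has_lbound (H @` S).
  (* Cone and midpoint inequalities give [H u0 - K0 * r + 2 * c * r ^+ 2 <= H y]; the constant is
     the minimum of this quadratic in [r]. *)
  exists (H u0 - K0 ^+ 2 / (8 * c)) => _ [y Sy <-].
  have := hK0 _ (Smid _ _ Sy Su0); have := Hmid _ _ Sy Su0.
  rewrite midE fnormZ ger0_norm//; set r := fnorm _ => h1 h2.
  have : 0 <= 2 * c * (r - K0 / (4 * c)) ^+ 2 by rewrite mulr_ge0 ?sqr_ge0 ?mulr_ge0// ltW.
  have -> : 2 * c * (r - K0 / (4 * c)) ^+ 2
      = 2 * (c * r ^+ 2) - K0 * r + K0 ^+ 2 / (8 * c) by field; rewrite lt0r_neq0.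
  move: h1 h2; rewrite mulrA; lra.
have infH : has_inf (H @` S) by split => //; exists (H u0), u0.
pose m := inf (H @` S).
have minm y : S y -> m <= H y by move=> Sy; apply: ge_inf => //; exists y.
have /choice[u hu] k : exists y, S y /\ H y < m + k.+1%:R^-1.
  have [|_ [y Sy <-] hy] := @inf_adherent _ _ (k.+1%:R^-1) _ infH.
    by rewrite invr_gt0.
  by exists y.
have [l ul] : exists l, (fun k => fnorm (u k - l)) @ \oo --> (0 : R).
  apply: fnorm_complete => e e0.
  have [K hK] := @inv_succ_eventually_lt R (c * e ^+ 2) (mulr_gt0 c0 (exprn_gt0 _ e0)).
  exists K => i j Ki Kj; have [Si Hi] := hu i; have [Sj Hj] := hu j.
  have h1 := hK _ Ki; have h2 := hK _ Kj.
  have h3 := Hmid _ _ Si Sj; have h4 := minm _ (Smid _ _ Si Sj).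
  rewrite -(ltr_pXn2r (_ : 0 < 2)%N) ?nnegrE ?fnorm_ge0 ?(ltW e0)//.
  rewrite -(ltr_pM2l c0); move: (le_trans h4 h3) Hi Hj h1 h2.
  move: (i.+1%:R^-1) (j.+1%:R^-1) (fnorm _ ^+ 2) (e ^+ 2) (H _) (H _) => *.
  lra.
have Sl : S l by exact: (closed_fnorm _ _ _ Scl (fun k => (hu k).1) ul).
have Hl : H l <= m.
  have [K hK] := Hlow _ Sl.
  rewrite leNgt; apply/negP => mHl.
  (* Half of the excess goes to the gap between [H (u k)] and [m], half to the cone term
     [K * fnorm (u k - l)]. *)
  pose e := (H l - m) / 2; have e0 : 0 < e by rewrite /e; lra.
  have [N1 hN1] := inv_succ_eventually_lt e0.
  pose e' := e / (`|K| + 1).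
  have K1 : 0 < `|K| + 1 by rewrite ltr_pwDr.
  have e'0 : 0 < e' by rewrite divr_gt0.
  have /cvgrPdist_lt/(_ _ e'0)[N2 _ hN2] := ul.
  pose k := maxn N1 N2.
  have h1 := hN1 k (leq_maxl _ _); have := hN2 k (leq_maxr _ _).
  rewrite /= sub0r normrN ger0_norm ?fnorm_ge0// => h2.
  have [Sk Hk] := hu k; have h3 := hK _ Sk.
  have h4 : K * fnorm (u k - l) <= e.
    apply: (@le_trans _ _ ((`|K| + 1) * e')).
      apply: (@le_trans _ _ ((`|K| + 1) * fnorm (u k - l))).
        by rewrite ler_wpM2r ?fnorm_ge0// (le_trans (ler_norm _))// lerDl.
      by rewrite ler_wpM2l ?(ltW K1)// ltW.
    by rewrite /e' mulrC divfK// lt0r_neq0.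
  move: h1 h3 h4 Hk mHl; rewrite /e.
  move: (k.+1%:R^-1) (K * _) (H (u k)) (H l) => *; lra.
exists l => // y Sy.
have := le_trans (minm _ (Smid _ _ Sy Sl)) (Hmid _ _ Sy Sl).
move: (fnorm _ ^+ 2) Hl => *; lra.
Qed.

(** * Convex functions: bounds on boxes and cone minorants *)

Lemma convex_functionE {R : realType} {p} {G : 'rV[R]_p -> R} {t : R} x y :
  convex_function setT G -> 0 <= t -> t <= 1 ->
  G (t *: x + (1 - t) *: y) <= t * G x + (1 - t) * G y.
Proof.
move=> cG t0 t1; exact: (cG (Itv01 t0 t1) x y (mem_setT _) (mem_setT _)).
Qed.

Lemma convex_setE {R : realType} {p} {S : set 'rV[R]_p} {t : R} {x y} :
  convex_set (S : set (convex_lmodType 'rV[R]_p)) -> 0 <= t -> t <= 1 ->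
  S x -> S y -> S (t *: x + (1 - t) *: y).
Proof.
move=> cS t0 t1 Sx Sy; have := cS x y (Itv01 t0 t1) (mem_set Sx) (mem_set Sy).
by rewrite inE.
Qed.

(** A coefficient in [-1, 1] along [e i] gives a convex combination of the endpoints [u + e i] and
    [u - e i]. Induction on the directions therefore needs the bound at both shifted centres. *)
Lemma convex_box_bound {R : realType} {p} (G : 'rV[R]_p -> R) {I : Type} (s : seq I)
    (e : I -> 'rV[R]_p) :
  convex_function setT G ->
  forall u, exists M, forall c : I -> R, (forall j, `|c j| <= 1) ->
    G (u + \sum_(j <- s) c j *: e j) <= M.
Proof.
move=> cG; elim: s => [|i s IH] u.
  by exists (G u) => c _; rewrite big_nil addr0.
have [M1 h1] := IH (u + e i); have [M2 h2] := IH (u - e i).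
exists (Num.max M1 M2) => c hc; rewrite big_cons.
set S := \sum_(j <- s) _; pose t := (1 + c i) / 2.
have := hc i; rewrite ler_norml => /andP[ci1 ci2].
have t0 : 0 <= t by rewrite /t; lra.
have t1 : t <= 1 by rewrite /t; lra.
have -> : u + (c i *: e i + S) = t *: (u + e i + S) + (1 - t) *: (u - e i + S).
  by apply/rowP => j; rewrite !mxE /t; field.
apply: (le_trans (convex_functionE _ _ cG t0 t1)).
have -> : Num.max M1 M2 = t * Num.max M1 M2 + (1 - t) * Num.max M1 M2 by ring.
apply: lerD; apply: ler_wpM2l => //; rewrite ?subr_ge0// le_max.
  by rewrite h1.
by rewrite h2 ?orbT.
Qed.

(* Bounding [G] above on a box around [u] and reflecting through [u] bounds it below by a cone at [u]. *)
Lemma convex_cone_minorant {R : realType} {p} (G : 'rV[R]_p -> R) u :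
  convex_function setT G -> exists K, forall y, G u - K * fnorm (y - u) <= G y.
Proof.
move=> cG; have [M hM] := convex_box_bound G (index_enum 'I_p) (fun j => 'e_j) cG u.
exists (M - G u) => y; set r := fnorm (y - u).
have [r0|r_neq0] := eqVneq r 0.
  by have := fnorm_eq0 (y - u); rewrite -/r r0 lexx mulr0 subr0 => /(_ isT)/subr0_eq ->.
have rp : 0 < r by rewrite lt_neqAle eq_sym r_neq0 fnorm_ge0.
(* The unit vector opposite to [y - u]: [u] is the average of [y] and [u + h] with weights 1/(1+r)
   and r/(1+r). *)
pose h := - r^-1 *: (y - u).
have hb : G (u + h) <= M.
  rewrite [h]row_sum_delta; apply: (hM (fun j => h 0 j)) => j.
  apply: (le_trans (coord_le_fnorm h j)).
  by rewrite /h fnormZ normrN gtr0_norm ?invr_gt0// mulVf.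
have r1 : 0 < 1 + r by rewrite addr_gt0.
have r1n : 1 + r != 0 by rewrite lt0r_neq0.
have i0 : 0 <= (1 + r)^-1 by rewrite invr_ge0 ltW.
have i1 : (1 + r)^-1 <= 1 by rewrite invf_le1// lerDl ltW.
have := convex_functionE y (u + h) cG i0 i1.
have -> : (1 + r)^-1 *: y + (1 - (1 + r)^-1) *: (u + h) = u.
  by apply/rowP => j; rewrite !mxE; field; rewrite r1n r_neq0.
move=> h1; have : (1 + r) * G u <= G y + r * G (u + h).
  rewrite -(ler_pM2l r1) in h1; apply: (le_trans h1).
  by rewrite le_eqVlt; apply/orP; left; apply/eqP; field.
have : r * G (u + h) <= r * M by rewrite ler_pM2l.
lra.
Qed.

(** * Moreau envelopes *)

Lemma fnorm_sqrD {R : realType} {p} (u v : 'rV[R]_p) :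
  fnorm (u + v) ^+ 2 = fnorm u ^+ 2 + 2 * dotv u v + fnorm v ^+ 2.
Proof. by rewrite !fnorm_sqr !dotv_lin (dotvC v u); ring. Qed.

(** Division by [t] and a small [t]: this is how first-order conditions are extracted from
    minimality along segments. *)
Lemma ge0_of_quadratic {R : realType} (A B : R) :
  (forall t, 0 < t -> t <= 1 -> 0 <= t * A + t ^+ 2 * B) -> 0 <= A.
Proof.
move=> h; rewrite leNgt; apply/negP => A0.
(* [D] dominates both [B] and [- A], so that the [t] below is at most 1 and [t * B <= - A / 2]. *)
pose D := `|B| - A; have D0 : 0 < D by rewrite /D subr_gt0 (lt_le_trans A0).
have := normr_ge0 B; have := ler_norm B => B1 B0.
pose t := - A / (2 * D); have t0 : 0 < t by rewrite divr_gt0 ?mulr_gt0// oppr_gt0.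
have t1 : t <= 1 by rewrite ler_pdivrMr ?mulr_gt0// /D; lra.
have := h t t0 t1; rewrite expr2 -mulrA -mulrDr pmulr_rge0// => h1.
have : t * B <= t * D by rewrite ler_pM2l// /D; lra.
have -> : t * D = - A / 2 by rewrite /t; field; rewrite lt0r_neq0.
lra.
Qed.

(** The penalty outweighs the weak convexity: the sum is strongly convex of modulus [2 * a - rho],
    hence has midpoint constant [(2 * a - rho) / 8]. The minimiser [q] is the proximal point. *)
Lemma quadratic_penalty_min {R : realType} {p} (F : 'rV[R]_p -> R) (rho a : R) x :
  convex_function setT (fun z => F z + rho / 2 * fnorm z ^+ 2) -> rho < 2 * a ->
  exists q, forall y, F q + a * fnorm (q - x) ^+ 2 + (2 * a - rho) / 4 * fnorm (y - q) ^+ 2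
     <= F y + a * fnorm (y - x) ^+ 2.
Proof.
move=> cF ra; pose c := (2 * a - rho) / 8.
have c0 : 0 < c by rewrite /c divr_gt0// subr_gt0.
have [|||||q _ hq] := @strongly_convex_min _ _ setT (fun y => F y + a * fnorm (y - x) ^+ 2) c c0.
- by exists 0.
- exact: closedT.
- by [].
- move=> u v _ _.
  have h0 : (0 : R) <= 2^-1 by lra.
  have h1 : (2^-1 : R) <= 1 by lra.
  have := convex_functionE u v cF h0 h1.
  have -> : 2^-1 *: u + (1 - 2^-1) *: v = 2^-1 *: (u + v).
    by apply/rowP => j; rewrite !mxE; field.
  rewrite !fnorm_sqr !dotv_lin (dotvC v u) (dotvC x u) (dotvC x v).
  move: (F _) (F _) (F _) (dotv u u) (dotv v v) (dotv u v) (dotv u x) (dotv v x) (dotv x x).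
  by rewrite /c => *; lra.
- move=> u _; have [K hK] := convex_cone_minorant _ u cF.
  (* The cone of the convexified function is widened by Cauchy-Schwarz bounds on the linear terms of
     the quadratics at [u]; the remaining [(a - rho / 2) * r ^+ 2] is nonnegative. *)
  exists (K + 2 * (a - rho / 2) * fnorm u + 2 * `|a| * fnorm x) => y _.
  have := hK y; have := dotv_ge u (y - u); have := dotv_le x (y - u).
  set r := fnorm (y - u) => hx hu h.
  have r0 : 0 <= r by exact: fnorm_ge0.
  have e1 : fnorm y ^+ 2 = fnorm u ^+ 2 + 2 * dotv u (y - u) + r ^+ 2.
    by rewrite -fnorm_sqrD addrC subrK.
  have e2 z : fnorm (z - x) ^+ 2 = fnorm z ^+ 2 - 2 * dotv x z + fnorm x ^+ 2.
    by rewrite fnorm_sqrD dotvNr fnormN (dotvC z x) mulrN.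
  have e3 : dotv x y = dotv x u + dotv x (y - u) by rewrite -dotvDr addrC subrK.
  rewrite !e2 e3 e1; rewrite e1 in h.
  have k0 : 0 < a - rho / 2 by lra.
  have b1 : - ((a - rho / 2) * (fnorm u * r)) <= (a - rho / 2) * dotv u (y - u).
    by rewrite -mulrN ler_wpM2l// ltW.
  have b2 : a * dotv x (y - u) <= `|a| * (fnorm x * r).
    apply: (le_trans (ler_norm _)); rewrite normrM ler_wpM2l//.
    by rewrite ler_norml dotv_le dotv_ge.
  have b3 : 0 <= (a - rho / 2) * r ^+ 2 by rewrite mulr_ge0 ?sqr_ge0// ltW.
  move: h b1 b2 b3.
  move: (F y) (F u) (fnorm u) (fnorm x) (fnorm u ^+ 2) (fnorm x ^+ 2) (dotv u _) (dotv x _) (dotv x _) (`|a|).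
  move=> *; lra.
exists q => y; have := hq y I; rewrite /c.
by have -> : 2 * ((2 * a - rho) / 8) = (2 * a - rho) / 4 by field.
Qed.

Lemma derive_quadratic_error {R : realType} {p} (F : 'rV[R]_p -> R) x v l C :
  (forall t, `|F (t *: v + x) - F x - t * l| <= C * t ^+ 2) -> derive F x v = l.
Proof.
move=> h; apply: cvg_lim => //.
have C0 : 0 <= C.
  by have := h 1; rewrite expr1n mulr1; apply: le_trans; exact: normr_ge0.
apply/cvgrPdist_le => e e0.
have C1 : 0 < C + 1 by rewrite ltr_pwDr.
near=> t.
have t0 : t != 0 by near: t; exact: nbhs_dnbhs_neq.
have te : `|t| <= e / (C + 1).
  near: t; apply: dnbhs0_le; exact: divr_gt0.
rewrite /= distrC /GRing.scale /=.
have -> : t^-1 * (F (t *: v + x) - F x) - l = t^-1 * (F (t *: v + x) - F x - t * l).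
  by field.
rewrite normrM normfV ler_pdivrMl ?normr_gt0//.
apply: (le_trans (h t)); rewrite -[t ^+ 2]real_normK ?num_real// expr2 mulrCA.
rewrite ler_wpM2l//; apply: (@le_trans _ _ ((C + 1) * `|t|)).
  by rewrite ler_wpM2r// lerDl.
by rewrite mulrC -ler_pdivlMr.
Unshelve. all: by end_near. Qed.

(** [grad] consists of directional derivatives along the basis, so the error constant may depend on
    the direction. *)
Lemma grad_quadratic_error {R : realType} {p} (F : 'rV[R]_p -> R) x g :
  (forall v, exists C, forall t, `|F (x + t *: v) - F x - t * dotv g v| <= C * t ^+ 2) ->
  grad F x = g.
Proof.
move=> h; apply/rowP => j; rewrite mxE.
have [C hC] := h (delta_mx 0 j).
apply: (@derive_quadratic_error _ _ _ _ _ _ C) => t; have := hC t.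
rewrite [x + _]addrC; congr (`|_ - _ - t * _| <= _).
rewrite /dotv (bigD1 j)//= mxE !eqxx mulr1 big1 ?addr0// => i ij.
by rewrite mxE (negbTE ij) mulr0.
Qed.

(** The Moreau envelope in a single block, with [a] in the place of [(2 * eta)^-1]. *)
Definition envelope {R : realType} {p} (a : R) (F : 'rV[R]_p -> R) (x : 'rV[R]_p) : R :=
  inf (range (fun y => F y + a * fnorm (y - x) ^+ 2)).

Lemma envelopeE {R : realType} {p} (a : R) (F : 'rV[R]_p -> R) x q :
  (forall y, F q + a * fnorm (q - x) ^+ 2 <= F y + a * fnorm (y - x) ^+ 2) ->
  envelope a F x = F q + a * fnorm (q - x) ^+ 2.
Proof.
move=> h; apply/eqP; rewrite eq_le; apply/andP; split.
  by apply: ge_inf; [exists (F q + a * fnorm (q - x) ^+ 2) => _ [y _ <-] | exists q].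
by apply: lb_le_inf => [|_ [y _ <-]//]; exists (F q + a * fnorm (q - x) ^+ 2), q.
Qed.

(* The growth of the penalised function at its minimiser [q] controls the envelope from below, so that continuity of the proximal map is not needed. *)
Lemma grad_envelope {R : realType} {p} (a k : R) (F : 'rV[R]_p -> R) x q :
  0 < a -> 0 < k ->
  (forall y, F q + a * fnorm (q - x) ^+ 2 + k * fnorm (y - q) ^+ 2
     <= F y + a * fnorm (y - x) ^+ 2) ->
  grad (envelope a F) x = (2 * a) *: (x - q).
Proof.
move=> a0 k0 hq; apply: grad_quadratic_error => v.
have sqE y t : fnorm (y - (x + t *: v)) ^+ 2
    = fnorm (y - x) ^+ 2 - t * (2 * dotv (y - q) v) + t * (2 * dotv (x - q) v)
      + t ^+ 2 * fnorm v ^+ 2.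
  by rewrite !fnorm_sqr !dotv_lin (dotvC v) (dotvC x y) (dotvC v x); ring.
(* The cross term in [y - q] is absorbed by the growth [k * fnorm (y - q) ^+ 2] at the cost of
   [a ^+ 2 / k]. The summand [a * fnorm v ^+ 2] is the error of the upper bound, so that one
   constant serves both sides. *)
have low y t : F q + a * fnorm (q - x) ^+ 2 + t * dotv ((2 * a) *: (x - q)) v
    - (a * fnorm v ^+ 2 + a ^+ 2 / k * fnorm v ^+ 2) * t ^+ 2
    <= F y + a * fnorm (y - (x + t *: v)) ^+ 2.
  rewrite sqE dotvZl; have h := hq y.
  have h1 : a * (t * (2 * dotv (y - q) v)) <= `|2 * a * t| * (fnorm (y - q) * fnorm v).
    apply: (@le_trans _ _ (`|2 * a * t * dotv (y - q) v|)).
      by apply: le_trans (ler_norm _); rewrite le_eqVlt; apply/orP; left; apply/eqP; ring.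
    by rewrite normrM ler_wpM2l// ler_norml dotv_le dotv_ge.
  have h2 : 0 <= k * (fnorm (y - q) - a * `|t| / k * fnorm v) ^+ 2.
    by rewrite mulr_ge0 ?sqr_ge0// ltW.
  have h3 : k * (fnorm (y - q) - a * `|t| / k * fnorm v) ^+ 2
     = k * fnorm (y - q) ^+ 2 - `|2 * a * t| * (fnorm (y - q) * fnorm v)
       + a ^+ 2 / k * fnorm v ^+ 2 * t ^+ 2.
    rewrite -[t ^+ 2]real_normK ?num_real// !normrM (gtr0_norm a0) ger0_norm//.
    by field; rewrite lt0r_neq0.
  rewrite h3 in h2.
  have h4 : 0 <= a * (t ^+ 2 * fnorm v ^+ 2) by exact: mulr_ge0 (ltW a0) (mulr_ge0 (sqr_ge0 _) (sqr_ge0 _)).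
  have h5 : 0 <= a * fnorm v ^+ 2 * t ^+ 2 by exact: mulr_ge0 (mulr_ge0 (ltW a0) (sqr_ge0 _)) (sqr_ge0 _).
  move: h h1 h2 h4 h5.
  move: (F y) (F q) (fnorm (y - x) ^+ 2) (fnorm (q - x) ^+ 2) (dotv (y - q) v) (dotv (x - q) v).
  move: (fnorm (y - q) ^+ 2) (fnorm (y - q) * fnorm v) (`|2 * a * t|) (fnorm v ^+ 2) (a ^+ 2 / k).
  move=> *; lra.
have qE : envelope a F x = F q + a * fnorm (q - x) ^+ 2.
  apply: envelopeE => y; apply: le_trans (hq y).
  by rewrite lerDl mulr_ge0 ?sqr_ge0// ltW.
exists (a * fnorm v ^+ 2 + a ^+ 2 / k * fnorm v ^+ 2) => t; rewrite qE ler_norml.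
have D0 : 0 <= a ^+ 2 / k * fnorm v ^+ 2 * t ^+ 2.
  apply: mulr_ge0 (sqr_ge0 _); apply: mulr_ge0 (sqr_ge0 _).
  by apply: divr_ge0; [exact: sqr_ge0 | exact: ltW].
apply/andP; split.
  rewrite lerBrDr lerBrDr; apply: lb_le_inf => [|_ [y _ <-]].
    by exists (F q + a * fnorm (q - (x + t *: v)) ^+ 2), q.
  by apply: le_trans (low y t); move: (F q) (dotv _ _) => *; lra.
(* For the upper bound, [q] is kept as competitor at the shifted point. *)
have := @ge_inf _ (range (fun y => F y + a * fnorm (y - (x + t *: v)) ^+ 2)).
move=> /(_ _ (F q + a * fnorm (q - (x + t *: v)) ^+ 2)) h.
have {h} : envelope a F (x + t *: v) <= F q + a * fnorm (q - (x + t *: v)) ^+ 2.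
  apply: h; last by exists q.
  eexists => _ [y _ <-]; exact: low y t.
rewrite sqE dotvZl subrr.
have -> : dotv (0 : 'rV[R]_p) v = 0 by rewrite -(scale0r 0) dotvZl mul0r.
move: D0; move: (envelope a F _) (F q) (fnorm (q - x) ^+ 2) (dotv _ _) (fnorm v ^+ 2) (a ^+ 2 / k).
move=> *; lra.
Qed.

(** * Weak subgradients and quadratic surrogates *)

(** First-order optimality of [q] on the segment towards [w]: minimality and convexity combine into
    a term linear in [t], with [(a - rho / 2) * fnorm (w - q) ^+ 2] as the coefficient of its
    square. *)
Lemma wsubdiff_penalty_min {R : realType} {p} (F : 'rV[R]_p -> R) (rho a : R) x q :
  convex_function setT (fun z => F z + rho / 2 * fnorm z ^+ 2) ->
  (forall y, F q + a * fnorm (q - x) ^+ 2 <= F y + a * fnorm (y - x) ^+ 2) ->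
  wsubdiff rho F q ((2 * a) *: (x - q)).
Proof.
move=> cF hq; exists ((2 * a) *: (x - q) + rho *: q); last by rewrite addrK.
move=> w; rewrite -subr_ge0; apply: (@ge0_of_quadratic _ _
  ((a - rho / 2) * fnorm (w - q) ^+ 2)) => t t0 t1.
have := convex_functionE w q cF (ltW t0) t1; rewrite /=.
have -> : t *: w + (1 - t) *: q = q + t *: (w - q).
  by apply/rowP => j; rewrite !mxE; ring.
have := hq (q + t *: (w - q)).
have -> : q + t *: (w - q) - x = (q - x) + t *: (w - q) by rewrite addrAC.
rewrite !(fnorm_sqrD _ (t *: _)) !fnormZ !exprMn real_normK ?num_real// !dotv_lin.
rewrite (dotvC x q) (dotvC q w).
move: (F q) (F w) (F _) (fnorm (q - x) ^+ 2) (fnorm w ^+ 2) (fnorm q ^+ 2).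
move: (fnorm (w - q) ^+ 2) (dotv x w) (dotv q x) (dotv w q) (dotv q q).
by move=> *; lra.
Qed.

(* Adding [t * (rho / 2) * |d|^2] to the quotient of [F] gives, up to a constant, the monotone difference quotient of the convexified function. *)
Lemma ddir_ge_wsubdiff {R : realType} {p} (F : 'rV[R]_p -> R) (rho : R) u b d :
  convex_function setT (fun z => F z + rho / 2 * fnorm z ^+ 2) ->
  wsubdiff rho F u b -> dotv b d <= ddir F u d.
Proof.
move=> cF [v hv <-]; set b' := v - rho *: u.
pose k := rho / 2 * fnorm d ^+ 2.
pose q t := t^-1 * (F (u + t *: d) - F u); pose r t := q t + t * k.
have rE t : 0 < t -> t * r t + t * (rho * dotv u d) =
    F (u + t *: d) + rho / 2 * fnorm (u + t *: d) ^+ 2 - (F u + rho / 2 * fnorm u ^+ 2).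
  move=> t0; rewrite /r /q /k fnorm_sqrD dotvZr fnormZ exprMn real_normK ?num_real//.
  by field; rewrite lt0r_neq0.
have r_ge t : 0 < t -> dotv b' d <= r t.
  move=> t0; rewrite -(ler_pM2l t0); have := hv (u + t *: d); have := rE _ t0.
  have -> : u + t *: d - u = t *: d by rewrite addrAC subrr add0r.
  rewrite /b' dotvDl dotvNl !dotvZl dotvZr => h1 h2; lra.
have r_mono s t : 0 < s -> s <= t -> r s <= r t.
  move=> s0 st; have t0 : 0 < t by exact: lt_le_trans st.
  have st0 : 0 <= s / t by rewrite divr_ge0 ?ltW.
  have st1 : s / t <= 1 by rewrite ler_pdivrMr// mul1r.
  have := convex_functionE (u + t *: d) u cF st0 st1.
  have -> : (s / t) *: (u + t *: d) + (1 - s / t) *: u = u + s *: d.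
    by apply/rowP => j; rewrite !mxE; field; rewrite lt0r_neq0.
  have := rE _ s0; have := rE _ t0.
  set A := F (u + t *: d) + _; set B := F (u + s *: d) + _; set C := F u + _.
  move=> ht hs h; rewrite -(ler_pM2l s0).
  have : s / t * (t * r t + t * (rho * dotv u d)) = s * r t + s * (rho * dotv u d).
    by field; rewrite lt0r_neq0.
  rewrite ht => h'; move: h hs h'; lra.
(* The [lim] in [ddir] is meaningful only once convergence is known; here it is monotone and bounded
   below. *)
have r_cvg : cvg (r t @[t --> 0^'+]).
  apply: nondecreasing_at_right_is_cvgr; apply: nearW => y.
    by move=> s t; rewrite !in_itv /= => /andP[s0 _] _ st; exact: r_mono.
  exists (dotv b' d) => _ [t /= + <-]; rewrite in_itv /= => /andP[t0 _]; exact: r_ge.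
have q_cvg : q t @[t --> 0^'+] --> lim (r t @[t --> 0^'+]).
  have -> : q = (fun t => r t - t * k) by apply/funext => t; rewrite /r addrK.
  have k_cvg : (fun t => t * k) @ 0^'+ --> 0 * k.
    by apply: cvgM; [apply: cvg_at_right_filter; exact: cvg_id | exact: cvg_cst].
  have := cvgB r_cvg k_cvg; rewrite mul0r subr0 => h; exact: h.
rewrite /ddir (cvg_lim _ q_cvg)//; apply: limr_ge => //.
by near=> t; apply: r_ge; near: t; exact: nbhs_right_gt.
Unshelve. all: by end_near. Qed.

(** Exact second-order Taylor expansion about [z]; minimality, strong convexity and the gradient of
    the surrogate are all read off it. *)
Lemma quadratic_expand {R : realType} {p} (c mu : R) (g y z z' : 'rV[R]_p) :
  c + dotv g (z' - y) + mu / 2 * fnorm (z' - y) ^+ 2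
  = c + dotv g (z - y) + mu / 2 * fnorm (z - y) ^+ 2
    + dotv (g + mu *: (z - y)) (z' - z) + mu / 2 * fnorm (z' - z) ^+ 2.
Proof.
have -> : z' - y = (z - y) + (z' - z) by rewrite [RHS]addrC subrKA.
by rewrite fnorm_sqrD !dotv_lin; field.
Qed.

Lemma quadratic_argminP {R : realType} {p} (S : set 'rV[R]_p) (c mu : R) (g y z : 'rV[R]_p) :
  convex_set (S : set (convex_lmodType 'rV[R]_p)) -> 0 < mu -> S z ->
  (forall z', S z' -> c + dotv g (z - y) + mu / 2 * fnorm (z - y) ^+ 2
     <= c + dotv g (z' - y) + mu / 2 * fnorm (z' - y) ^+ 2)
  <-> (forall z', S z' -> 0 <= dotv (g + mu *: (z - y)) (z' - z)).
Proof.
move=> cS mu0 Sz; split=> h z' Sz'; last first.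
  rewrite (quadratic_expand _ _ _ _ z z') -[leRHS]addrA lerDl addr_ge0 ?h//.
  by rewrite mulr_ge0 ?sqr_ge0// divr_ge0 ?ltW.
apply: (@ge0_of_quadratic _ _ (mu / 2 * fnorm (z' - z) ^+ 2)) => t t0 t1.
have := h _ (convex_setE cS (ltW t0) t1 Sz' Sz).
rewrite (quadratic_expand _ _ _ _ z (_ + _)) -[leRHS]addrA lerDl.
have -> : t *: z' + (1 - t) *: z - z = t *: (z' - z).
  by apply/rowP => j; rewrite !mxE; ring.
by rewrite dotvZr fnormZ exprMn real_normK ?num_real// mulrCA.
Qed.

Lemma quadratic_argmin_exists {R : realType} {p} (S : set 'rV[R]_p) (c mu : R) (g y : 'rV[R]_p) :
  S !=set0 -> closed S -> convex_set (S : set (convex_lmodType 'rV[R]_p)) -> 0 < mu ->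
  exists2 z, S z & forall z', S z' -> c + dotv g (z - y) + mu / 2 * fnorm (z - y) ^+ 2
     <= c + dotv g (z' - y) + mu / 2 * fnorm (z' - y) ^+ 2.
Proof.
move=> S0 Scl cS mu0; have mu8 : 0 < mu / 8 by rewrite divr_gt0.
have [|||z Sz hz] := @strongly_convex_min _ _ S
  (fun z => c + dotv g (z - y) + mu / 2 * fnorm (z - y) ^+ 2) (mu / 8) mu8 S0 Scl.
- move=> a b Sa Sb.
  have h0 : (0 : R) <= 2^-1 by lra.
  have h1 : (2^-1 : R) <= 1 by lra.
  have := convex_setE cS h0 h1 Sa Sb.
  by congr S; apply/rowP => j; rewrite !mxE; field.
- move=> a b Sa Sb; set m := 2^-1 *: (a + b).
  (* About the midpoint the linear terms are opposite and each remainder is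
     [mu / 8 * fnorm (a - b) ^+ 2]. *)
  rewrite (quadratic_expand _ _ _ _ m a) (quadratic_expand _ _ _ _ m b).
  have -> : a - m = 2^-1 *: (a - b) by apply/rowP => j; rewrite !mxE; field.
  have -> : b - m = - (2^-1 *: (a - b)) by apply/rowP => j; rewrite !mxE; field.
  rewrite fnormN fnormZ exprMn real_normK ?num_real// dotvNr.
  by rewrite le_eqVlt; apply/orP; left; apply/eqP; field.
- move=> u Su; exists (fnorm (g + mu *: (u - y))) => z Sz.
  rewrite (quadratic_expand _ _ _ _ u z) -[leRHS]addrA lerD2l.
  apply: (le_trans (dotv_ge _ _)); rewrite lerDl.
  by rewrite mulr_ge0 ?sqr_ge0// divr_ge0 ?ltW.
exists z => // z' Sz'; apply: le_trans (hz z' Sz').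
by rewrite lerDl mulr_ge0 ?sqr_ge0// mulr_ge0// ltW.
Qed.

(** The sum of the two variational inequalities. The vector [g - mu *: y] is the part of the
    surrogate gradient that does not depend on the evaluation point. *)
Lemma quadratic_argmin_dist {R : realType} {p} (mu : R) (g1 g2 y1 y2 z1 z2 : 'rV[R]_p) :
  0 < mu ->
  0 <= dotv (g1 + mu *: (z1 - y1)) (z2 - z1) ->
  0 <= dotv (g2 + mu *: (z2 - y2)) (z1 - z2) ->
  mu * fnorm (z1 - z2) <= fnorm (g1 - mu *: y1 - (g2 - mu *: y2)).
Proof.
move=> mu0 h1 h2; set w := g1 - _ - _; set r := fnorm _.
have h : mu * r ^+ 2 <= dotv w (z2 - z1).
  move: h1 h2; rewrite /w /r fnorm_sqr !dotv_lin (dotvC z2 z1); lra.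
have [r0|rn0] := eqVneq r 0; first by rewrite r0 mulr0 fnorm_ge0.
have rp : 0 < r by rewrite lt_neqAle eq_sym rn0 fnorm_ge0.
rewrite -(ler_pM2r rp) -mulrA -expr2; apply: (le_trans h).
by rewrite /r fnorm_distC; exact: dotv_le.
Qed.

Lemma grad_quadratic {R : realType} {p} (c mu : R) (g y x : 'rV[R]_p) :
  grad (fun z => c + dotv g (z - y) + mu / 2 * fnorm (z - y) ^+ 2) x = g + mu *: (x - y).
Proof.
apply: grad_quadratic_error => v; exists (`|mu / 2| * fnorm v ^+ 2) => t.
rewrite (quadratic_expand _ _ _ _ x (x + _)).
have -> : x + t *: v - x = t *: v by rewrite addrAC subrr add0r.
rewrite [X in `|X|](_ : _ = mu / 2 * fnorm v ^+ 2 * t ^+ 2); last first.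
  by rewrite dotvZr fnormZ exprMn real_normK ?num_real//; ring.
have vt0 : 0 <= fnorm v ^+ 2 * t ^+ 2 by rewrite mulr_ge0 ?sqr_ge0.
by rewrite -(mulrA (mu / 2)) -(mulrA `|mu / 2|) (normrM (mu / 2)) (ger0_norm vt0).
Qed.

(** * Profiles and contractions *)

Lemma fnorm_le_norm {R : realType} {p} (u : 'rV[R]_p) : fnorm u <= p%:R * `|u|.
Proof.
rewrite fnorm_rowE; under eq_bigr do rewrite -[_ ^+ 2]real_normK ?num_real//.
apply: (le_trans (sqrt_sum_sqr_le _ _ (fun j _ => normr_ge0 (u 0 j)))).
apply: (@le_trans _ _ (\sum_(j < p) `|u|)); last first.
  by rewrite sumr_const card_ord -[leLHS]mulr_natl.
apply: ler_sum => j _; rewrite [leRHS]mx_normrE.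
exact: (le_bigmax _ (fun ij => `|u ij.1 ij.2|) (0, j)).
Qed.

Lemma diam_ge {R : realType} {p} (S : set 'rV[R]_p) a b :
  compact S -> S a -> S b -> fnorm (a - b) <= diam S.
Proof.
move=> /compact_bounded[M [_ hM]] Sa Sb.
have {}hM u : S u -> `|u| <= M + 1 by apply: hM; rewrite ltrDl.
apply: sup_upper_bound; last by exists a, b.
split; first by exists (fnorm (a - b)), a, b.
exists (p%:R * (M + 1) + p%:R * (M + 1)) => _ [u [v [Su Sv ->]]].
apply: (le_trans (fnormD _ _)); rewrite fnormN.
by apply: lerD; apply: (le_trans (fnorm_le_norm _)); rewrite ler_wpM2l ?hM.
Qed.

(** If the distances have no supremum, [sup] takes its default value 0. *)
Lemma diam_ge0 {R : realType} {p} (S : set 'rV[R]_p) : 0 <= diam S.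
Proof.
rewrite /diam; set E := [set r | _].
have [hs|/sup_out ->//] := pselect (has_sup E).
have [[r [a [b [Sa Sb rE]]]] _] := hs.
apply: (@le_trans _ _ r); first by rewrite rE fnorm_ge0.
by apply: sup_upper_bound hs _ _; exists a, b.
Qed.

Lemma upd_in {R : realType} {N} {n : 'I_N -> nat} (x : prof R n) i z : upd x i z i = z.
Proof. exact: dfwithin. Qed.

Lemma upd_upd {R : realType} {N} {n : 'I_N -> nat} (x : prof R n) i z z' :
  upd (upd x i z) i z' = upd x i z'.
Proof.
apply: functional_extensionality_dep => j; rewrite /upd.
have [ij|ij] := eqVneq i j; first by subst j; rewrite !dfwithin.
by rewrite !dfwithout.
Qed.

(** With the other players frozen, the second update of block [i] overrides the first; this makes
    [grad_envelope] applicable. *)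
Lemma pgrad_moreau {R : realType} {N} {n : 'I_N -> nat} (eta : R) (F : prof R n -> R) i x :
  pgrad (moreau eta F i) i x = grad (envelope (2 * eta)^-1 (fun z => F (upd x i z))) (x i).
Proof.
suff E : (fun z => moreau eta F i (upd x i z)) = envelope (2 * eta)^-1 (fun z => F (upd x i z)).
  by rewrite /pgrad E.
apply/funext => z; rewrite /moreau /envelope upd_in.
suff -> : (fun y => F (upd (upd x i z) i y) + (2 * eta)^-1 * fnorm (y - z) ^+ 2)
  = (fun y => F (upd x i y) + (2 * eta)^-1 * fnorm (y - z) ^+ 2) by [].
by apply/funext => y; rewrite upd_upd.
Qed.

Lemma pdist_ge0 {R : realType} {N} {n : 'I_N -> nat} (x y : prof R n) : 0 <= pdist x y.
Proof. exact: sqrtr_ge0. Qed.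

Lemma pdistxx {R : realType} {N} {n : 'I_N -> nat} (x : prof R n) : pdist x x = 0.
Proof.
by rewrite /pdist big1 ?sqrtr0// => i _; rewrite subrr fnorm_row0 expr0n.
Qed.

Lemma pdistC {R : realType} {N} {n : 'I_N -> nat} (x y : prof R n) : pdist x y = pdist y x.
Proof. by rewrite /pdist; under eq_bigr do rewrite fnorm_distC. Qed.

Lemma pdist_tri {R : realType} {N} {n : 'I_N -> nat} (y x z : prof R n) :
  pdist x z <= pdist x y + pdist y z.
Proof.
apply: le_trans (sum_sqr_minkowski _ _ _); apply: ler_wsqrtr; apply: ler_sum => i _.
by rewrite ler_pXn2r ?nnegrE ?addr_ge0 ?fnorm_ge0// fnorm_tri.
Qed.

Lemma coord_le_pdist {R : realType} {N} {n : 'I_N -> nat} (x y : prof R n) i :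
  fnorm (x i - y i) <= pdist x y.
Proof.
rewrite -[leLHS]ger0_norm ?fnorm_ge0// -sqrtr_sqr ler_wsqrtr// (bigD1 i)//= lerDl.
by apply: sumr_ge0 => j _; exact: sqr_ge0.
Qed.

Lemma pdist_le_sum {R : realType} {N} {n : 'I_N -> nat} (x y : prof R n) :
  pdist x y <= \sum_i fnorm (x i - y i).
Proof. by apply: sqrt_sum_sqr_le => i _; exact: fnorm_ge0. Qed.

Lemma pdist_minus_le_sum {R : realType} {N} {n : 'I_N -> nat} i (x y : prof R n) :
  pdist_minus i x y <= \sum_(j < N | j != i) fnorm (x j - y j).
Proof. by apply: sqrt_sum_sqr_le => j _; exact: fnorm_ge0. Qed.

Lemma pdist_eq0 {R : realType} {N} {n : 'I_N -> nat} (x y : prof R n) :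
  pdist x y <= 0 -> x = y.
Proof.
move=> h; apply: functional_extensionality_dep => i; apply/subr0_eq/fnorm_eq0.
exact: le_trans (coord_le_pdist x y i) h.
Qed.

(** * Spectral norm, perturbed contractions and fixed points *)

Lemma specnorm_set_has_sup {R : realType} {m} (A : 'M[R]_m) :
  has_sup [set fnorm (A *m v) | v in [set v : 'cV[R]_m | fnorm v <= 1]].
Proof.
split.
  exists (fnorm (A *m (0 : 'cV[R]_m))), 0 => //=.
  by rewrite fnorm_colE big1 ?sqrtr0// => i _; rewrite mxE expr0n.
exists (\sum_i \sum_j `|A i j|) => _ [v /= v1 <-]; rewrite fnorm_colE.
under [in leLHS]eq_bigr do rewrite -[_ ^+ 2]real_normK ?num_real//.
apply: (le_trans (sqrt_sum_sqr_le _ _ (fun j _ => normr_ge0 _))).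
apply: ler_sum => i _; rewrite mxE; apply: (le_trans (ler_norm_sum _ _ _)).
apply: ler_sum => j _; rewrite normrM ler_piMr//; apply: le_trans v1.
rewrite fnorm_colE -sqrtr_sqr ler_wsqrtr// (bigD1 j)//= lerDl.
by apply: sumr_ge0 => k _; exact: sqr_ge0.
Qed.

Lemma specnorm_ge0 {R : realType} {m} (A : 'M[R]_m) : 0 <= specnorm A.
Proof.
have [[r [v v1 rE]] _] := specnorm_set_has_sup A.
apply: (@le_trans _ _ r); first by rewrite -rE fnorm_ge0.
by apply: sup_upper_bound (specnorm_set_has_sup A) _ _; exists v.
Qed.

Lemma fnorm_mul_col {R : realType} {m} (A : 'M[R]_m) (v : 'cV[R]_m) :
  fnorm (A *m v) <= specnorm A * fnorm v.
Proof.
have fZ t (w : 'cV[R]_m) : fnorm (t *: w) = `|t| * fnorm w.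
  rewrite !fnorm_colE -sqrtr_sqr -sqrtrM ?sqr_ge0// mulr_sumr; congr Num.sqrt.
  by apply: eq_bigr => j _; rewrite mxE exprMn.
have [v0|vn0] := eqVneq (fnorm v) 0.
  suff -> : v = 0.
    rewrite mulmx0 [leLHS](_ : _ = 0) ?mulr_ge0 ?specnorm_ge0 ?fnorm_ge0//.
    by rewrite fnorm_colE big1 ?sqrtr0// => i _; rewrite mxE expr0n.
  apply: trmx_inj; rewrite trmx0; apply: fnorm_eq0; rewrite -v0 fnorm_rowE fnorm_colE.
  by under eq_bigr do rewrite mxE.
have vp : 0 < fnorm v by rewrite lt_neqAle eq_sym vn0 fnorm_ge0.
rewrite -ler_pdivrMr// mulrC -[X in X * _ <= _]ger0_norm ?invr_ge0 ?fnorm_ge0//.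
rewrite -fZ scalemxAr; apply: sup_upper_bound (specnorm_set_has_sup A) _ _.
by exists ((fnorm v)^-1 *: v) => //=; rewrite fZ gtr0_norm ?invr_gt0// mulVf.
Qed.

(** Applied to the column of block distances. The hypothesis itself makes the entries of [A *m v]
    nonnegative, so squaring preserves the componentwise bound. *)
Lemma specnorm_contraction {R : realType} {N} {n : 'I_N -> nat} (A : 'M[R]_N)
    (x x' y y' : prof R n) :
  (forall i, fnorm (x' i - y' i) <= \sum_j A i j * fnorm (x j - y j)) ->
  pdist x' y' <= specnorm A * pdist x y.
Proof.
move=> h; pose v : 'cV[R]_N := \col_j fnorm (x j - y j).
have -> : pdist x y = fnorm v by rewrite fnorm_colE; under [in RHS]eq_bigr do rewrite mxE.
apply: le_trans (fnorm_mul_col A v); rewrite [leRHS]fnorm_colE; apply: ler_wsqrtr.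
apply: ler_sum => i _; rewrite !mxE; under eq_bigr do rewrite mxE.
have s0 : 0 <= \sum_j A i j * fnorm (x j - y j) by apply: le_trans (h i); exact: fnorm_ge0.
by rewrite ler_pXn2r ?nnegrE ?fnorm_ge0.
Qed.

Lemma summable_cvg0 {R : realType} (u : nat -> R) C :
  (forall k, 0 <= u k) -> (forall K, \sum_(k < K) u k <= C) -> u @ \oo --> (0 : R).
Proof.
move=> u0 uC; apply: cvg_series_cvg_0; apply: nondecreasing_is_cvgn.
  apply/nondecreasing_seqP => k; rewrite /series /= big_nat_recr//= lerDl; exact: u0.
by exists C => _ [k _ <-]; rewrite /series /= big_mkord.
Qed.

(* Summing the recursion bounds the partial sums of [T], which is stronger than convergence. *)
Lemma perturbed_contraction_cvg0 {R : realType} (T e : nat -> R) q C :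
  q < 1 -> (forall k, 0 <= T k) -> (forall k, T k.+1 <= q * T k + e k) ->
  (forall K, \sum_(k < K) e k <= C) -> T @ \oo --> (0 : R).
Proof.
move=> q1 T0 Te eC; have q1' : 0 < 1 - q by rewrite subr_gt0.
apply: (@summable_cvg0 _ _ ((1 - q)^-1 * (T 0%N + C))) => // K.
rewrite ler_pdivlMl//.
(* The left side is [T 0%N] plus the sum of the [T k.+1], to which the recursion applies
   termwise. *)
suff h : \sum_(k < K) T k + T K <= T 0%N + q * \sum_(k < K) T k + \sum_(k < K) e k.
  by have := eC K; have := T0 K; move: h; lra.
elim: K => [|K IH]; first by rewrite !big_ord0; lra.
rewrite !big_ord_recr /=; have := Te K; move: IH; lra.
Qed.

Lemma pdist_cvg0 {R : realType} {N} {n : 'I_N -> nat} (u : nat -> prof R n) l :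
  (forall i, (fun k => fnorm (u k i - l i)) @ \oo --> (0 : R)) ->
  (fun k => pdist (u k) l) @ \oo --> (0 : R).
Proof.
move=> h.
have s : (fun k => \sum_i fnorm (u k i - l i)) @ \oo --> \sum_(i < N) (0 : R).
  by apply: cvg_big => [|i _]; [exact: add_continuous | exact: h].
rewrite big1// in s.
apply: (squeeze_cvgr _ (cvg_cst 0) s).
by apply: nearW => k; rewrite pdist_ge0 pdist_le_sum.
Qed.

(** Picard iteration. Completeness is used block by block, since [pdist] dominates every block
    distance. *)
Lemma prof_banach {R : realType} {N} {n : 'I_N -> nat} (X : forall i, set 'rV[R]_(n i))
    (b : prof R n -> prof R n) (q : R) :
  (forall i, X i !=set0) -> (forall i, closed (X i)) ->
  (forall y, inX X y -> inX X (b y)) -> q < 1 -> 0 <= q ->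
  (forall y w, inX X y -> inX X w -> pdist (b y) (b w) <= q * pdist y w) ->
  exists2 x, inX X x & b x = x.
Proof.
move=> X0 Xcl bX q1 q0 bq; pose x0 : prof R n := fun i => xget 0 (X i).
have Xx0 : inX X x0 by move=> i; exact: xgetPex (X0 i).
pose u k := iter k b x0.
have Xu k : inX X (u k) by elim: k => [|k IH] //; exact: bX.
have q1' : 0 < 1 - q by rewrite subr_gt0.
(* [D] solves [D = pdist (b x0) x0 + q * D], so the iterates never leave the ball of radius [D]
   about [x0]. *)
pose D := pdist (b x0) x0 / (1 - q).
have D0 : 0 <= D by rewrite divr_ge0 ?pdist_ge0// ltW.
have u0D m : pdist (u m) x0 <= D.
  elim: m => [|m IH]; first by rewrite pdistxx.
  apply: (le_trans (pdist_tri (b x0) _ _)).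
  have h1 : pdist (u m.+1) (b x0) <= q * D.
    by apply: (le_trans (bq _ _ (Xu m) Xx0)); rewrite ler_wpM2l.
  have h2 : pdist (b x0) x0 = (1 - q) * D by rewrite /D mulrC divfK// lt0r_neq0.
  by rewrite h2; lra.
have uq k m : pdist (u (k + m)) (u k) <= q ^+ k * D.
  elim: k => [|k IH]; first by rewrite expr0 mul1r.
  apply: (le_trans (bq _ _ (Xu _) (Xu _))).
  by rewrite exprS -mulrA ler_wpM2l.
have hl i : exists l, (fun k => fnorm (u k i - l)) @ \oo --> (0 : R).
  apply: fnorm_complete => e e0.
  have D1 : 0 < D + 1 by rewrite ltr_pwDr.
  have e'0 : 0 < e / (D + 1) / 2 by rewrite !divr_gt0.
  have qn1 : `|q| < 1 by rewrite ger0_norm.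
  have /cvgrPdist_lt/(_ _ e'0)[K _ /(_ K (leqnn _))] := cvg_expr qn1.
  rewrite sub0r normrN ger0_norm ?exprn_ge0// => hK.
  exists K => a c Ka Kc.
  have dist j : (K <= j)%N -> fnorm (u j i - u K i) < e / 2.
    move=> Kj; apply: (le_lt_trans (coord_le_pdist _ _ _)).
    rewrite -(subnKC Kj); apply: (le_lt_trans (uq _ _)).
    apply: (@le_lt_trans _ _ (q ^+ K * (D + 1))).
      by rewrite ler_wpM2l ?exprn_ge0// lerDl.
    by rewrite -ltr_pdivlMr// mulrAC.
  apply: (le_lt_trans (fnorm_tri (u K i) _ _)); rewrite (fnorm_distC (u K i)).
  by have := dist _ Ka; have := dist _ Kc; lra.
pose l i := projT1 (cid (hl i)).
have ul i : (fun k => fnorm (u k i - l i)) @ \oo --> (0 : R) := projT2 (cid (hl i)).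
have Xl : inX X l by move=> i; apply: (closed_fnorm _ _ _ (Xcl i) (fun k => Xu k i) (ul i)).
have ucvg := pdist_cvg0 u l ul.
(* If [l] were moved by [b], two consecutive iterates closer to [l] than half of that distance would
   contradict the contraction. *)
exists l => //; apply: pdist_eq0; rewrite leNgt; apply/negP => h.
have h2 : 0 < pdist (b l) l / 2 by rewrite divr_gt0.
have /cvgrPdist_lt/(_ _ h2)[K _ hK] := ucvg.
have := hK K (leqnn _); have := hK K.+1 (leqnSn _).
rewrite !sub0r !normrN !ger0_norm ?pdist_ge0// => h3 h4.
have := pdist_tri (u K.+1) (b l) l; have := bq _ _ Xl (Xu K).
rewrite (pdistC l); have : q * pdist (u K) l <= pdist (u K) l.
  by rewrite ler_piMl ?pdist_ge0// ltW.
rewrite -/(u K.+1); move: (pdist (b l) (u K.+1)) h3 h4; rewrite /u /=.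
move: (pdist _ _) (pdist _ _) (pdist _ _) => *; lra.
Qed.

(** * Measurability and almost sure summability *)

Lemma prof_borel_open {R : realType} {N} {n : 'I_N -> nat} (A : set (prof R n)) :
  prof_open A -> prof_borel A.
Proof. exact: sub_smallest. Qed.

(** As [phi] is controlled only on [X], its superlevel sets need not be open. The open set [O], a
    union of balls, agrees with the superlevel set on [X], where [x] takes its values. *)
Lemma measurable_fun_prof {R : realType} {N} {n : 'I_N -> nat} {d} {T : measurableType d}
    (X : forall i, set 'rV[R]_(n i)) (x : T -> prof R n) (phi : prof R n -> R) :
  (forall A, prof_borel A -> measurable (x @^-1` A)) -> (forall w, inX X (x w)) ->
  (forall y z, inX X y -> inX X z -> phi y - phi z <= pdist y z) ->
  measurable_fun setT (fun w => phi (x w)).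
Proof.
move=> mx Xx phi1 mD; apply: (measurability _ (RGenOInfty.measurableE R)) => //.
move=> _ [_ [c ->] <-]; rewrite setTI.
pose O : set (prof R n) := fun y' => exists y r, [/\ inX X y, pdist y y' < r &
  forall z, inX X z -> pdist y z < r -> c < phi z].
have oO : prof_open O.
  move=> y' [y [r [Xy yy' h]]]; exists (r - pdist y y'); first by rewrite subr_gt0.
  move=> z y'z; exists y, r; split => //.
  by apply: (le_lt_trans (pdist_tri y' _ _)); rewrite -ltrBrDl.
have := mx _ (prof_borel_open _ oO); congr measurable; apply/seteqP; split => w /=.
  by move=> [y [r [Xy yx h]]]; rewrite in_itv /= andbT h.
rewrite in_itv /= andbT => cw; exists (x w), (phi (x w) - c); split => //.
  by rewrite pdistxx subr_gt0.
by move=> z Xz; have := phi1 _ _ (Xx w) Xz; lra.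
Qed.

Lemma measurable_fnorm {R : realType} {d} {T : measurableType d} {p} (v : T -> 'rV[R]_p) :
  (forall j, measurable_fun setT (fun w => v w 0 j)) ->
  measurable_fun setT (fun w => fnorm (v w)).
Proof.
move=> mv; have -> : (fun w => fnorm (v w)) = Num.sqrt \o (fun w => \sum_(j < p) v w 0 j ^+ 2).
  by apply/funext => w; rewrite fnorm_rowE.
apply: measurableT_comp; first by apply: continuous_measurable_fun; exact: sqrt_continuous.
by apply: measurable_sum => j; exact: measurable_funX.
Qed.

Lemma integral_cst_probability {R : realType} {d} {T : measurableType d}
    (P : probability T R) (c : R) : (\int[P]_w (cst c%:E w) = c%:E)%E.
Proof.
rewrite integral_cst// -[RHS]mule1; congr (_ * _)%E; exact: probability_setT.
Qed.

(** The defining identity on the whole space gives the expectation of [g]; as [g] carries no sign,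
    it is bounded through its positive part, which is almost surely at most [c]. *)
Lemma cexp_le_as_integral {R : realType} {d} {T : measurableType d}
    (P : probability T R) (G : set (set T)) (Y : T -> R) c :
  (forall A, G A -> measurable A) -> G setT -> 0 <= c -> cexp_le_as P G Y c ->
  (\int[P]_w (Y w)%:E <= c%:E)%E.
Proof.
move=> mG GT c0 [g [mg intg gc]]; rewrite -intg//.
have mgE : measurable_fun setT (EFin \o g).
  by apply/measurable_EFinP => _ A mA; rewrite setTI; exact/mG/mg.
rewrite integralE; apply: (@le_trans _ _ (\int[P]_w (EFin \o g)^\+ w)%E).
  by rewrite -[leRHS]adde0 leeD// oppe_le0 integral_ge0.
apply: (@le_trans _ _ (\int[P]_w (cst c%:E w))%E); last first.
  by rewrite integral_cst_probability.
apply: ae_ge0_le_integral => //.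
- exact: measurable_funepos.
- by move: gc; apply: filterS => w gw _; rewrite funeposE ge_max !lee_fin gw.
Qed.

(* AM-GM in place of Cauchy-Schwarz: [e <= (e^2 / a + a) / 2]. *)
Lemma integral_le_of_sqr {R : realType} {d} {T : measurableType d}
    (P : probability T R) (e : T -> R) a :
  measurable_fun setT e -> (forall w, 0 <= e w) -> 0 < a ->
  (\int[P]_w (e w ^+ 2)%:E <= (a ^+ 2)%:E)%E -> (\int[P]_w (e w)%:E <= a%:E)%E.
Proof.
move=> me e0 a0 h.
have k0 : 0 <= (2 * a)^-1 by rewrite invr_ge0 mulr_ge0// ltW.
have a20 : 0 <= a / 2 by rewrite divr_ge0// ltW.
have me2 : measurable_fun setT (fun w => (e w ^+ 2)%:E).
  by apply/measurable_EFinP; exact: measurable_funX.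
have e20 w : (0 <= (e w ^+ 2)%:E)%E by rewrite lee_fin sqr_ge0.
apply: (@le_trans _ _ (\int[P]_w ((2 * a)^-1%:E * (e w ^+ 2)%:E + (a / 2)%:E))%E).
  apply: ge0_le_integral => //.
  - by move=> w _; rewrite lee_fin.
  - exact/measurable_EFinP.
  - by apply: emeasurable_funD => //; exact: measurable_funeM.
  - move=> w _; rewrite -EFinM -EFinD lee_fin -subr_ge0.
    have -> : (2 * a)^-1 * e w ^+ 2 + a / 2 - e w = (2 * a)^-1 * (e w - a) ^+ 2.
      by field; rewrite lt0r_neq0.
    by rewrite mulr_ge0 ?sqr_ge0.
rewrite ge0_integralD//; last 2 first.
- by move=> w _; rewrite mule_ge0.
- exact: measurable_funeM.
rewrite ge0_integralZl_EFin// (integral_cst_probability P (a / 2)).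
apply: (@le_trans _ _ ((2 * a)^-1%:E * (a ^+ 2)%:E + (a / 2)%:E)%E).
  by rewrite leeD2r// lee_wpmul2l// lee_fin.
rewrite -EFinM -EFinD lee_fin le_eqVlt; apply/orP; left; apply/eqP.
by field; rewrite lt0r_neq0.
Qed.

(** By monotone convergence the total sum has expectation at most [C], hence is almost surely
    finite, and it bounds its partial sums. *)
Lemma ae_bounded_partial_sums {R : realType} {d} {T : measurableType d}
    (P : probability T R) (Z : nat -> T -> R) (a : nat -> R) C :
  (forall k, measurable_fun setT (Z k)) -> (forall k w, 0 <= Z k w) ->
  (forall k, (\int[P]_w (Z k w)%:E <= (a k)%:E)%E) -> (forall K, \sum_(k < K) a k <= C) ->
  {ae P, forall w, exists C', forall K, \sum_(k < K) Z k w <= C'}.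
Proof.
move=> mZ Z0 Za aC.
have mZE k : measurable_fun setT (fun w => (Z k w)%:E) by exact/measurable_EFinP.
pose S w := (\sum_(0 <= k <oo) (Z k w)%:E)%E.
have S0 w : (0 <= S w)%E by apply: nneseries_ge0 => k _ _; rewrite lee_fin.
have intS : (\int[P]_w S w <= C%:E)%E.
  rewrite /S integral_nneseries//; last by move=> k w _; rewrite lee_fin.
  apply: lime_le.
    by apply: is_cvg_nneseries => k _ _; apply: integral_ge0 => w _; rewrite lee_fin.
  apply: nearW => K; apply: (@le_trans _ _ (\sum_(0 <= k < K) (a k)%:E)%E).
    by apply: lee_sum => k _; exact: Za.
  by rewrite sumEFin lee_fin big_mkord.
have iS : P.-integrable setT S.
  apply/integrableP; split.
    by apply: ge0_emeasurable_sum => // k w _ _; rewrite lee_fin.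
  under eq_integral do rewrite gee0_abs//.
  exact: le_lt_trans intS (ltry _).
have := integrable_ae measurableT iS; apply: filterS => w /(_ I) Sfin.
exists (fine (S w)) => K; rewrite -lee_fin fineK// -sumEFin.
rewrite -(big_mkord xpredT (fun k => (Z k w)%:E)).
by apply: nneseries_lim_ge => k _ _; rewrite lee_fin.
Qed.

(** * Best responses and equilibria *)

(** Existence of a minimiser ensures that [xget] returns one and not its default 0. *)
Lemma bestresp_variational {R : realType} {N} {n : 'I_N -> nat} (X : forall i, set 'rV[R]_(n i))
    (eta mu : R) (f : 'I_N -> prof R n -> R) (y : prof R n) i :
  X i !=set0 -> closed (X i) -> convex_set (X i : set (convex_lmodType 'rV[R]_(n i))) -> 0 < mu ->
  X i (bestresp X eta mu f y i) /\
  forall z, X i z -> 0 <= dotv (pgrad (moreau eta (f i) i) i y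
    + mu *: (bestresp X eta mu f y i - y i)) (z - bestresp X eta mu f y i).
Proof.
move=> X0 Xcl Xcv mu0.
have [z Xz hz] := quadratic_argmin_exists (X i) (moreau eta (f i) i y) mu
  (pgrad (moreau eta (f i) i) i y) (y i) X0 Xcl Xcv mu0.
have [Xb hb] : [set z | X i z /\ forall z', X i z' ->
    surr eta mu (f i) i z y <= surr eta mu (f i) i z' y] (bestresp X eta mu f y i).
  by apply: xgetPex; exists z.
split => // z' Xz'; exact: (quadratic_argminP _ _ _ _ _ _ Xcv mu0 Xb).1 hb z' Xz'.
Qed.

(** At a fixed point the [mu] term vanishes. Conversely [x] and its best response solve the same
    variational inequality, whose solution is unique by [quadratic_argmin_dist]. *)
Lemma bestresp_fixed_smoothed_qne {R : realType} {N} {n : 'I_N -> nat}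
    (X : forall i, set 'rV[R]_(n i)) (eta mu : R) (f : 'I_N -> prof R n -> R) (x : prof R n) :
  (forall i, X i !=set0) -> (forall i, closed (X i)) ->
  (forall i, convex_set (X i : set (convex_lmodType 'rV[R]_(n i)))) -> 0 < mu -> inX X x ->
  bestresp X eta mu f x = x <-> smoothed_qne X f eta x.
Proof.
move=> X0 Xcl Xcv mu0 Xx; split => [bx|[_ hx]].
  split => // i z Xz.
  have [_ /(_ z Xz)] := bestresp_variational X eta mu f x i (X0 i) (Xcl i) (Xcv i) mu0.
  by rewrite bx subrr scaler0 addr0.
apply: functional_extensionality_dep => i; apply/subr0_eq/fnorm_eq0.
have [Xb hb] := bestresp_variational X eta mu f x i (X0 i) (Xcl i) (Xcv i) mu0.
have h2 : 0 <= dotv (pgrad (moreau eta (f i) i) i x + mu *: (x i - x i))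
    (bestresp X eta mu f x i - x i) by rewrite subrr scaler0 addr0 hx.
have := quadratic_argmin_dist _ _ _ _ _ _ _ mu0 (hb _ (Xx i)) h2.
by rewrite subrr fnorm_row0 pmulr_rle0.
Qed.

Lemma bestresp_dist {R : realType} {N} {n : 'I_N -> nat} (X : forall i, set 'rV[R]_(n i))
    (f : 'I_N -> prof R n -> R) (eta mu : R) (Lh Lhm : 'I_N -> R) :
  (forall i, X i !=set0) -> (forall i, closed (X i)) ->
  (forall i, convex_set (X i : set (convex_lmodType 'rV[R]_(n i)))) -> 0 < mu ->
  (forall i, 0 <= Lhm i) ->
  (forall i (xi : 'rV[R]_(n i)) (y w : prof R n),
     X i xi -> inX X y -> inX X w ->
     fnorm (grad (fun z => surr eta mu (f i) i z y) xi
            - grad (fun z => surr eta mu (f i) i z w) xi)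
       <= Lh i * fnorm (y i - w i) + Lhm i * pdist_minus i y w) ->
  forall y w, inX X y -> inX X w -> forall i,
    fnorm (bestresp X eta mu f y i - bestresp X eta mu f w i)
      <= \sum_(j < N) Gamma2 mu Lh Lhm i j * fnorm (y j - w j).
Proof.
move=> X0 Xcl Xcv mu0 Lhm0 C1 y w Xy Xw i.
have [Xb1 hb1] := bestresp_variational X eta mu f y i (X0 i) (Xcl i) (Xcv i) mu0.
have [Xb2 hb2] := bestresp_variational X eta mu f w i (X0 i) (Xcl i) (Xcv i) mu0.
(* Any point [xi] will do: the difference of the two gradients does not depend on it. *)
have [xi Xxi] := X0 i; have := C1 i xi y w Xxi Xy Xw.
rewrite /surr !grad_quadratic.
have vecE (g1 g2 y1 y2 : 'rV[R]_(n i)) :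
    g1 + mu *: (xi - y1) - (g2 + mu *: (xi - y2)) = g1 - mu *: y1 - (g2 - mu *: y2).
  by apply/rowP => j; rewrite !mxE; ring.
rewrite vecE.
move=> h; have := le_trans (quadratic_argmin_dist _ _ _ _ _ _ _ mu0 (hb1 _ Xb2) (hb2 _ Xb1)) h.
move=> {}h; rewrite -(ler_pM2l mu0); apply: (le_trans h).
rewrite (bigD1 i)//= mxE eqxx mulrDr; apply: lerD.
  by rewrite mulrA [mu * _]mulrC divfK// lt0r_neq0.
rewrite mulr_sumr; apply: (le_trans (ler_wpM2l (Lhm0 i) (pdist_minus_le_sum i y w))).
rewrite mulr_sumr; apply: ler_sum => j ji; rewrite mxE eq_sym (negbTE ji).
by rewrite mulrA [mu * _]mulrC divfK// lt0r_neq0.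
Qed.

Lemma smoothed_qne_eps_qne {R : realType} {N} {n : 'I_N -> nat} (X : forall i, set 'rV[R]_(n i))
    (f : 'I_N -> prof R n -> R) (rho : 'I_N -> R) (eta : R) (L : 'I_N -> R) (xs : prof R n) :
  (forall i (x : prof R n),
     convex_function setT
       (fun z : 'rV[R]_(n i) => f i (upd x i z) + rho i / 2 * fnorm z ^+ 2)) ->
  0 < eta -> (forall i, 0 < rho i) -> (forall i, eta < (rho i)^-1) ->
  (forall i, compact (X i)) -> (forall i, 0 <= L i) ->
  (forall i (x : prof R n),
     setLipschitz (L i) (wsubdiff (rho i) (fun z => f i (upd x i z)))) ->
  smoothed_qne X f eta xs ->
  eps_qne X f
    (eta * \big[Num.max/0]_(i < N) L i
         * \big[Num.max/0]_(i < N) diam (X i)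
         * \big[Num.max/0]_(i < N) fnorm (pgrad (moreau eta (f i) i) i xs)) xs.
Proof.
move=> cf eta0 rho0 eta_rho Xc L0 lip [Xxs hxs]; split => // i z Xz.
pose a := (2 * eta)^-1; pose F := fun z => f i (upd xs i z); pose x := xs i.
have a0 : 0 < a by rewrite invr_gt0 mulr_gt0.
have a2 : 2 * a = eta^-1 by rewrite /a invfM mulrA divff ?mul1r.
(* The bound on [eta] is exactly the strong convexity of the proximal problem. *)
have rho_a : rho i < 2 * a by rewrite a2 -(invrK (rho i)) ltf_pV2// posrE ?invr_gt0.
have [q hq] := quadratic_penalty_min F (rho i) a x (cf i xs) rho_a.
have k0 : 0 < (2 * a - rho i) / 4 by rewrite divr_gt0// subr_gt0.
set g := pgrad (moreau eta (f i) i) i xs.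
have gE : g = (2 * a) *: (x - q).
  by rewrite /g pgrad_moreau; exact: grad_envelope a0 k0 hq.
have gq : wsubdiff (rho i) F q g.
  rewrite gE; apply: (wsubdiff_penalty_min F (rho i) a x q (cf i xs)) => y.
  apply: le_trans (hq y).
  by rewrite lerDl mulr_ge0 ?sqr_ge0// ltW.
(* The subgradient [g] at [q] is carried to a subgradient [b] at [x]; only [g - b] contributes a
   loss, as [g] satisfies the smoothed variational inequality. *)
have [b bx gb] := lip i xs q x g gq.
have qx : fnorm (q - x) = eta * fnorm g.
  rewrite gE a2 fnormZ gtr0_norm ?invr_gt0// mulrA divff ?lt0r_neq0// mul1r.
  exact: fnorm_distC.
rewrite qx in gb.
apply: le_trans (ddir_ge_wsubdiff F (rho i) x b (z - x) (cf i xs) bx).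
have -> : dotv b (z - x) = dotv g (z - x) - dotv (g - b) (z - x).
  by rewrite dotvDl dotvNl; ring.
have h1 := dotv_le (g - b) (z - x); have h2 := hxs i z Xz; rewrite -/g -/x in h2.
have h3 : fnorm (g - b) * fnorm (z - x) <= L i * (eta * fnorm g) * diam (X i).
  by apply: ler_pM; rewrite ?fnorm_ge0// diam_ge.
have hL : L i <= \big[Num.max/0]_(i < N) L i by exact: (le_bigmax _ L i).
have hD : diam (X i) <= \big[Num.max/0]_(i < N) diam (X i).
  exact: (le_bigmax _ (fun i => diam (X i)) i).
have hM : fnorm g <= \big[Num.max/0]_(i < N) fnorm (pgrad (moreau eta (f i) i) i xs).
  exact: (le_bigmax _ (fun i => fnorm (pgrad (moreau eta (f i) i) i xs)) i).
move: hL hD hM; set ML := \big[Num.max/0]_(_ < N) L _; set MD := \big[_/_]_(_ < _) diam _.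
set MM := \big[_/_]_(_ < _) fnorm _ => hL hD hM.
have h4 : L i * (eta * fnorm g) * diam (X i) <= eta * ML * MD * MM.
  have -> : L i * (eta * fnorm g) * diam (X i) = eta * L i * diam (X i) * fnorm g by ring.
  apply: ler_pM => //; rewrite ?fnorm_ge0 ?mulr_ge0 ?diam_ge0 ?(ltW eta0)//.
  by apply: ler_pM; rewrite ?mulr_ge0 ?diam_ge0 ?(ltW eta0)// ler_pM2l.
lra.
Qed.

(** * Almost sure convergence of the inexact scheme *)

Lemma sum_half_le1 {R : realType} K : \sum_(k < K) (2 : R)^-1 ^+ k.+1 <= 1.
Proof.
suff -> : \sum_(k < K) (2 : R)^-1 ^+ k.+1 = 1 - 2^-1 ^+ K by rewrite gerBl exprn_ge0.
elim: K => [|K IH]; first by rewrite big_ord0 expr0 subrr.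
by rewrite big_ord_recr IH /= exprS; field.
Qed.

(** Conditional second moments bound the expected errors, whose summability gives summable errors on
    almost every path; on such a path the deterministic [perturbed_contraction_cvg0] applies. *)
Lemma inexact_contraction_cvg {R : realType} {N} {n : 'I_N -> nat}
    (X : forall i, set 'rV[R]_(n i)) (b : prof R n -> prof R n) (q : R) (xs : prof R n)
    {d} {T : measurableType d} (P : probability T R) (x : nat -> T -> prof R n)
    (eps : 'I_N -> nat -> R) :
  0 <= q -> q < 1 ->
  (forall y w, inX X y -> inX X w -> pdist (b y) (b w) <= q * pdist y w) ->
  inX X xs -> b xs = xs ->
  (forall k A, prof_borel A -> measurable (x k @^-1` A)) ->
  (forall k w, inX X (x k w)) ->
  (forall i k, 0 <= eps i k) ->
  (forall i, exists C : R, forall K, \sum_(k < K) eps i k <= C) ->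
  (forall k i, cexp_le_as P [set x k @^-1` A | A in prof_borel]
     (fun w => fnorm (x k.+1 w i - b (x k w) i) ^+ 2) (eps i k ^+ 2)) ->
  {ae P, forall w, (fun k => pdist (x k w) xs) @ \oo --> 0}.
Proof.
move=> q0 q1 bq Xxs bxs mx Xx eps0 epsC hexp.
pose e i k w := fnorm (x k.+1 w i - b (x k w) i).
have me i k : measurable_fun setT (e i k).
  apply: measurable_fnorm => j.
  have -> : (fun w => (x k.+1 w i - b (x k w) i) 0 j)
      = (fun w => x k.+1 w i 0 j) \- (fun w => b (x k w) i 0 j).
    by apply/funext => w; rewrite !mxE.
  have coord (y z : prof R n) : y i 0 j - z i 0 j <= pdist y z.
    apply: le_trans (coord_le_pdist y z i); apply: le_trans (coord_le_fnorm _ j).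
    by rewrite !mxE ler_norm.
  apply: measurable_funB.
    exact: (measurable_fun_prof X (x k.+1) (fun y => y i 0 j) (mx _) (Xx _)).
  (* Coordinates of [b] are 1-Lipschitz on [X] because [b] contracts there. *)
  apply: (measurable_fun_prof X (x k) (fun y => b y i 0 j) (mx _) (Xx _)) => y z Xy Xz.
  apply: (le_trans (coord _ _)); apply: (le_trans (bq _ _ Xy Xz)).
  by rewrite ler_piMl ?pdist_ge0// ltW.
have aeC i : {ae P, forall w, exists C, forall K, \sum_(k < K) e i k w <= C}.
  have [C hC] := epsC i.
  (* Some [eps i k] may vanish while [integral_le_of_sqr] asks for a positive bound; the geometric
     padding adds at most 1 to the sum. *)
  apply: (ae_bounded_partial_sums P (e i) (fun k => eps i k + 2^-1 ^+ k.+1) (C + 1)) => //.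
  - by move=> k w; exact: fnorm_ge0.
  - move=> k; have d0 : (0 : R) < 2^-1 ^+ k.+1 by rewrite exprn_gt0.
    apply: integral_le_of_sqr => //.
    + by move=> w; exact: fnorm_ge0.
    + by rewrite ltr_wpDl.
    + apply: (@le_trans _ _ (eps i k ^+ 2)%:E); last first.
        by rewrite lee_fin ler_pXn2r ?nnegrE ?addr_ge0// ?(ltW d0)// lerDl ltW.
      apply: cexp_le_as_integral (hexp k i); last exact: sqr_ge0.
      * by move=> _ [A mA <-]; exact: mx.
      * exists setT => //; apply: prof_borel_open => y _; exists 1 => //.
  - move=> K; rewrite big_split /=; apply: lerD; [exact: hC | exact: sum_half_le1].
have : {ae P, forall w, forall i, exists C, forall K, \sum_(k < K) e i k w <= C}.
  exact: filter_forall aeC.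
apply: filterS => w hw.
pose C i := projT1 (cid (hw i)).
have hC i K : \sum_(k < K) e i k w <= C i := projT2 (cid (hw i)) K.
apply: (perturbed_contraction_cvg0 _ (fun k => \sum_i e i k w) q (\sum_i C i)) => //.
- by move=> k; exact: pdist_ge0.
- move=> k; apply: (le_trans (pdist_tri (b (x k w)) _ _)); rewrite addrC; apply: lerD.
    by rewrite -[in leLHS]bxs; apply: bq.
  exact: pdist_le_sum.
- by move=> K; rewrite exchange_big /=; apply: ler_sum => i _; exact: hC.
Qed.

Theorem theorem4p3 (R : realType) (N : nat) (n : 'I_N -> nat)
  (X : forall i : 'I_N, set 'rV[R]_(n i))
  (f : 'I_N -> prof R n -> R) (rho : 'I_N -> R) (eta mu : R)
  (Lh Lhm : 'I_N -> R) :
  (* standing assumptions: X_i nonempty closed convex, f_i(., x_{-i}) rho_i-weakly convex *)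
  (forall i, X i !=set0) ->
  (forall i, closed (X i)) ->
  (forall i, convex_set (X i : set (convex_lmodType 'rV[R]_(n i)))) ->
  (forall i, 0 < rho i) ->
  (forall i (x : prof R n),
     convex_function setT
       (fun z : 'rV[R]_(n i) => f i (upd x i z) + rho i / 2 * fnorm z ^+ 2)) ->
  (* 0 < eta < min_i rho_i^-1, mu > 0 *)
  0 < eta -> (forall i, eta < (rho i)^-1) -> 0 < mu ->
  (forall i, 0 <= Lh i) -> (forall i, 0 <= Lhm i) ->
  (* (C1) *)
  (forall i (xi : 'rV[R]_(n i)) (y w : prof R n),
     X i xi -> inX X y -> inX X w ->
     fnorm (grad (fun z => surr eta mu (f i) i z y) xi
            - grad (fun z => surr eta mu (f i) i z w) xi)
       <= Lh i * fnorm (y i - w i) + Lhm i * pdist_minus i y w) ->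
  (* (C2) *)
  specnorm (Gamma2 mu Lh Lhm) < 1 ->
  [/\ (* (i) *)
      (forall y w, inX X y -> inX X w -> forall i,
         fnorm (bestresp X eta mu f y i - bestresp X eta mu f w i)
           <= \sum_(j < N) Gamma2 mu Lh Lhm i j * fnorm (y j - w j)),
      (forall y, inX X y -> inX X (bestresp X eta mu f y)),
      (exists2 q : R, 0 <= q < 1 & forall y w, inX X y -> inX X w ->
         pdist (bestresp X eta mu f y) (bestresp X eta mu f w) <= q * pdist y w)
    & exists xs : prof R n,
      [/\ inX X xs /\ bestresp X eta mu f xs = xs,
          (forall x, inX X x -> bestresp X eta mu f x = x -> x = xs),
          (* (ii) *)
          smoothed_qne X f eta xs /\ (forall x, smoothed_qne X f eta x -> x = xs),
          ((forall i, compact (X i)) ->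
           forall L : 'I_N -> R, (forall i, 0 <= L i) ->
           (forall i (x : prof R n),
              setLipschitz (L i) (wsubdiff (rho i) (fun z => f i (upd x i z)))) ->
           eps_qne X f
             (eta * \big[Num.max/0]_(i < N) L i
                  * \big[Num.max/0]_(i < N) diam (X i)
                  * \big[Num.max/0]_(i < N) fnorm (pgrad (moreau eta (f i) i) i xs))
             xs)
        & (* (iii) MS-SSBR *)
          (forall (d : measure_display) (T : measurableType d) (P : probability T R)
                  (x : nat -> T -> prof R n) (eps : 'I_N -> nat -> R),
           (forall k A, prof_borel A -> measurable (x k @^-1` A)) ->
           (exists2 x0, inX X x0 & forall w, x 0%N w = x0) ->
           (forall k w, inX X (x k w)) ->
           (forall i k, 0 <= eps i k) ->
           (forall i, exists C : R, forall K, \sum_(k < K) eps i k <= C) ->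
           (forall k i,
              cexp_le_as P [set x k @^-1` A | A in prof_borel]
                (fun w => fnorm (x k.+1 w i - bestresp X eta mu f (x k w) i) ^+ 2)
                (eps i k ^+ 2)) ->
           {ae P, forall w, (fun k => pdist (x k w) xs) @ \oo --> 0})]].
Proof.
move=> X0 Xcl Xcv rho0 cf eta0 eta_rho mu0 Lh0 Lhm0 C1 C2.
have dist := bestresp_dist X f eta mu Lh Lhm X0 Xcl Xcv mu0 Lhm0 C1.
have Xb y : inX X y -> inX X (bestresp X eta mu f y).
  by move=> _ i; case: (bestresp_variational X eta mu f y i (X0 i) (Xcl i) (Xcv i) mu0).
have q0 := specnorm_ge0 (Gamma2 mu Lh Lhm).
have contr y w : inX X y -> inX X w ->
    pdist (bestresp X eta mu f y) (bestresp X eta mu f w)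
      <= specnorm (Gamma2 mu Lh Lhm) * pdist y w.
  by move=> Xy Xw; apply: specnorm_contraction => i; exact: dist.
have [xs Xxs bxs] := prof_banach X _ _ X0 Xcl Xb C2 q0 contr.
have uniq x : inX X x -> bestresp X eta mu f x = x -> x = xs.
  (* Two fixed points have a distance at most [q] times itself with [q < 1], [q] being the spectral
     norm. *)
  move=> Xx bx; apply: pdist_eq0; have := contr x xs Xx Xxs; rewrite bx bxs.
  rewrite -subr_ge0 -[X in _ - X]mul1r -mulrBl nmulr_rge0// subr_lt0//.
have qneP x (Xx : inX X x) := bestresp_fixed_smoothed_qne X eta mu f x X0 Xcl Xcv mu0 Xx.
split => //; first by exists (specnorm (Gamma2 mu Lh Lhm)); rewrite ?q0.
exists xs; split => //.
- split; first exact/qneP.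
  by move=> x sx; have Xx := sx.1; apply: uniq => //; exact/qneP.
- move=> Xc L L0 lip; apply: (smoothed_qne_eps_qne X f rho) => //; exact/qneP.
- move=> d T P x eps mx _ Xx eps0 epsC hexp.
  exact: inexact_contraction_cvg q0 C2 contr Xxs bxs mx Xx eps0 epsC hexp.
Qed.
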